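(* Let $H$ and $G$ be separable infinite-dimensional complex Hilbert spaces, and let $A$ in $H$ and $Q$ in $G$ be self-adjoint unbounded linear operators with $\mathrm{Spec}\,A\subseteq[1,\infty)$ and $\mathrm{Spec}\,Q\subseteq[1,\infty)$. Let $\varphi_0,\varphi_1,\eta_0,\eta_1:[1,\infty)\to(0,\infty)$ be Borel measurable functions such that $\varphi_0/\varphi_1$ and $\eta_0/\eta_1$ are bounded on $[1,\infty)$. Let $\psi\in\mathcal{B}$ be pseudoconcave in a neighbourhood of infinity, and put $$\varphi(t):=\varphi_0(t)\,\psi\Bigl(\frac{\varphi_1(t)}{\varphi_0(t)}\Bigr),\qquad \eta(t):=\eta_0(t)\,\psi\Bigl(\frac{\eta_1(t)}{\eta_0(t)}\Bigr)\qquad(t\ge1).$$ Suppose that $c_{\psi,\nu}>0$ is a number such that $$\frac{\psi(t)}{\psi(\tau)}\le c_{\psi,\nu}\max\Bigl\{1,\frac{t}{\tau}\Bigr\}\quad\text{for all } t,\tau>0,$$ and let $\widetilde{\psi}(\lambda):=\sup_{t>0}\psi(\lambda t)/\psi(t)$ for $\lambda>0$. Let $T\neq0$ be a linear mapping given on $H^{\varphi_0}_A$ whose restriction to $H^{\varphi_j}_A$ is a bounded operator $T:H^{\varphi_j}_A\to G^{\eta_j}_Q$, with norm denoted by $\|T\|_j$, for each $j\in\{0,1\}$. Then the norm $\|T\|$ of the bounded operator $T:H^{\varphi}_A\to G^{\eta}_Q$ satisfies $$\|T\|\le c_{\psi,\nu}^{2}\sqrt{8}\,\|T\|_0\,\w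idetilde{\psi}\Bigl(\frac{\|T\|_1}{\|T\|_0}\Bigr).$$
   Context: Spaces $H^\varphi_A$: for a Borel measurable function $\varphi:[1,\infty)\to(0,\infty)$ the self-adjoint operator $\varphi(A)$ in $H$ is defined by the spectral decomposition of $A$, and $H^{\varphi}_{A}$ is the Hilbert space obtained by completing $\mathrm{Dom}\,\varphi(A)$ in the norm $\|\varphi(A)u\|_H$. The spaces $G^{\eta}_Q$ are defined in the same way from $G$ and $Q$. If $\varphi_0/\varphi_1$ is bounded on $[1,\infty)$, the identity mapping on $\mathrm{Dom}\,\varphi_1(A)$ extends uniquely to a continuous embedding $H^{\varphi_1}_A\hookrightarrow H^{\varphi_0}_A$, by which $H^{\varphi_1}_A$ is regarded as a linear manifold in $H^{\varphi_0}_A$ (similarly for $G,Q$). In the setting of the claim $H^{\varphi_1}_A\hookrightarrow H^{\varphi}_A\hookrightarrow H^{\varphi_0}_A$ and $G^{\eta_1}_Q\hookrightarrow G^{\eta}_Q\hookrightarrow G^{\eta_0}_Q$ continuously, and the restriction of $T$ to $H^\varphi_A$ is a bounded operator from $H^\varphi_A$ to $G^\eta_Q$. $\mathcal{B}$ is the set of all Borel measurable functions $\psi:(0,\infty)\to(0,\infty)$ such that $\psi$ is bounded on each $[a,b]$ with $0<a<b<\infty$ and $1/\psi$ is bounded on each $[r,\infty)$ with $r>0$. A function $\psi\in\mathcal{B}$ is pseudoconcave in a neighbourhood of infinity if there exist $r>0$ and a concave function $\psi_1:(r,\infty)\to(0,\infty)$ such that $\psi/\psi_1$ and $\psi_1/\psi$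 are bounded on $(r,\infty)$. The subscript $\nu$ refers to $\nu:=\min\{\inf_{t\ge1}\varphi_1(t)/\varphi_0(t),\ \inf_{t\ge1}\eta_1(t)/\eta_0(t)\}>0$. Only the values of $\psi$ on $[\nu,\infty)$ influence $\varphi$ and $\eta$; it is a standing convention that $\psi$ has been (re)defined on $(0,\nu)$, e.g. by $\psi(t):=\psi(\nu)\nu^{-1}t$, so that the displayed inequality for $\psi(t)/\psi(\tau)$ holds for all $t,\tau>0$. *)

(* Defs.v *)
From HB Require Import structures.
From mathcomp Require Import all_boot all_order all_algebra.
From mathcomp Require Import sesquilinear complex.
From mathcomp Require Import all_classical all_reals all_analysis.

Set Implicit Arguments.
Unset Strict Implicit.
Unset Printing Implicit Defensive.

Import Order.TTheory GRing.Theory Num.Theory.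
Import numFieldNormedType.Exports.

Local Open Scope classical_set_scope.
Local Open Scope ring_scope.
Local Open Scope complex_scope.

(* As for the other forms of sesquilinear.v, [dotp] is linear in its first
   argument and conjugate-linear in its second one. *)
HB.mixin Record CompleteNormedModule_isHilbert (R : realType) V
    & CompleteNormedModule R[i] V := {
  dotp : {dot V for (@Num.conj R[i])} ;
  dotp_normE : forall u : V, `|u| ^+ 2 = dotp u u
}.

#[short(type="hilbertType")]
HB.structure Definition Hilbert (R : realType) :=
  {V of CompleteNormedModule R[i] V & CompleteNormedModule_isHilbert R V}.

(* The library norm of a complex normed space takes its values in [R[i]];
   [hnorm] is the same number seen in [R]. *)
Definition hnorm (R : realType) (V : normedModType R[i]) (u : V) : R :=
  complex.Re `|u|.

Definition separable (T : topologicalType) : Prop :=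
  exists2 S : set T, countable S & dense S.

Definition finite_dimensional (K : pzRingType) (V : lmodType K) : Prop :=
  exists (n : nat) (b : 'I_n -> V),
    forall u, exists c : 'I_n -> K, u = \sum_(i < n) c i *: b i.

(* Meaningful for bounded linear maps only: [sup] is 0 on unbounded sets. *)
Definition opnorm (R : realType) (U V : normedModType R[i])
    (T : {linear U -> V}) : R :=
  sup [set hnorm (T u) | u in [set u | hnorm u <= 1]].

(* A possibly unbounded linear operator in [H]; the values of [act] outside
   [dom] are irrelevant. *)
Record linop (R : realType) (H : hilbertType R) := Linop {
  dom : set H ;
  act :> H -> H ;
  dom0 : dom 0 ;
  domP : forall (a : R[i]) u v, dom u -> dom v -> dom (a *: u + v) ;
  act_linear : forall (a : R[i]) u v, dom u -> dom v ->
    act (a *: u + v) = a *: act u + act v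
}.

Section operators.
Context (R : realType) (H : hilbertType R).
Implicit Type A : linop H.

Definition adjoint_rel A (v w : H) : Prop :=
  forall u, dom A u -> dotp (A u) v = dotp u w.

(* [A] is densely defined and its graph is that of its adjoint. *)
Definition self_adjoint A : Prop :=
  dense (dom A) /\
  forall v w, adjoint_rel A v w <-> dom A v /\ w = A v.

Definition unbounded A : Prop :=
  ~ exists M : R, forall u, dom A u -> hnorm (A u) <= M * hnorm u.

Definition resolvent_set A : set R[i] := [set z |
  exists S : {linear H -> H}, [/\ continuous S,
    (forall v, dom A (S v) /\ A (S v) - z *: S v = v) &
    (forall u, dom A u -> S (A u - z *: u) = u)]].

Definition spectrum A : set R[i] := ~` resolvent_set A.

(* [spectral_distr E u B] is <E(B)u, u>. *)
Definition spectral_distr (E : set R -> {linear H -> H}) (u : H)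
    (B : set (measurableTypeR R)) : \bar R :=
  (complex.Re (dotp (E B u) u))%:E.

(* Projection-valued Borel measures on the line; the values of [E] on
   non-measurable sets are irrelevant. *)
Record proj_measure := ProjMeasure {
  pm_proj :> set R -> {linear H -> H} ;
  pm_setT : forall u, pm_proj setT u = u ;
  pm_setI : forall B C : set (measurableTypeR R),
    measurable B -> measurable C ->
    forall u, pm_proj (B `&` C) u = pm_proj B (pm_proj C u) ;
  pm_sym : forall B : set (measurableTypeR R), measurable B ->
    forall u v, dotp (pm_proj B u) v = dotp u (pm_proj B v) ;
  pm_sigma_additive : forall u, semi_sigma_additive (spectral_distr pm_proj u)
}.

(* [P] is the integral of the real function [f] over [D] with respect to [E]:
   u is in its domain iff f is square-integrable with respect to <E(.)u, u>,
   and then <Pu, u> is the integral of f.  By polarization this determines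
   [P] on its domain. *)
Definition is_spectral_integral (E : proj_measure) (D : set R) (f : R -> R)
    (P : linop H) : Prop :=
  (dom P = [set u | \int[spectral_distr E u]_(t in D) (f t ^+ 2)%:E < +oo]%E) /\
  (forall u, dom P u ->
    dotp (P u) u = (fine (\int[spectral_distr E u]_(t in D) (f t)%:E)%E)%:C).

(* [E] is the resolution of identity of [A], i.e. [A] is the integral of
   t dE(t). *)
Definition spectral_decomposition (A : linop H) (E : proj_measure) : Prop :=
  is_spectral_integral E setT idfun A.

(* A completion of Dom phi(A) in the norm |phi(A) u|, where A is given by its
   resolution of identity [E].  A completion is determined up to a unique
   isometric isomorphism compatible with [sp_inj], whose values outside
   Dom phi(A) are irrelevant. *)
Record phi_space (E : proj_measure) (phi : R -> R) := PhiSpace {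
  sp_op : linop H ;
  sp_opP : is_spectral_integral E `[1, +oo[ phi sp_op ;
  sp_sort :> hilbertType R ;
  sp_inj : H -> sp_sort ;
  sp_inj_linear : forall (a : R[i]) u v, dom sp_op u -> dom sp_op v ->
    sp_inj (a *: u + v) = a *: sp_inj u + sp_inj v ;
  sp_inj_norm : forall u, dom sp_op u -> `|sp_inj u| = `|sp_op u| ;
  sp_inj_dense : dense (sp_inj @` dom sp_op)
}.

(* [e] is the continuous embedding extending the identity of Dom phi1(A). *)
Definition is_embedding (E : proj_measure) (phi1 phi0 : R -> R)
    (X1 : phi_space E phi1) (X0 : phi_space E phi0)
    (e : {linear X1 -> X0}) : Prop :=
  [/\ forall u, dom (sp_op X1) u -> dom (sp_op X0) u /\
        e (sp_inj X1 u) = sp_inj X0 u,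
      continuous e & injective e].

End operators.

(* [T1 : X1 -> Y1] is the restriction of [T : X0 -> Y0] to [X1], where X1 and
   Y1 are regarded as subspaces of X0 and Y0 by the embeddings [e] and [f]. *)
Definition is_restriction (K : numDomainType)
    (X0 Y0 X1 Y1 : normedModType K)
    (e : {linear X1 -> X0}) (f : {linear Y1 -> Y0})
    (T : {linear X0 -> Y0}) (T1 : {linear X1 -> Y1}) : Prop :=
  forall u, T (e u) = f (T1 u).

Section parameters.
Context (R : realType).
Implicit Types phi psi : R -> R.

Definition borel_positive phi : Prop :=
  measurable_fun (`[1, +oo[ : set R) phi /\ forall t, 1 <= t -> 0 < phi t.

Definition classB psi : Prop :=
  [/\ measurable_fun (`]0, +oo[ : set R) psi,
      forall t, 0 < t -> 0 < psi t,
      forall a b : R, 0 < a -> a < b -> [bounded psi t | t in `[a, b]] &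
      forall r : R, 0 < r -> [bounded (psi t)^-1 | t in `[r, +oo[]].

Definition concave_function (D : set R) (f : R -> R) : Prop :=
  @convex_function R R^o D (fun t => - f t).

Definition pseudoconcave_near_infty psi : Prop :=
  exists (r : R) (psi1 : R -> R), [/\ 0 < r,
    forall t, r < t -> 0 < psi1 t,
    concave_function `]r, +oo[ psi1,
    [bounded psi t / psi1 t | t in `]r, +oo[] &
    [bounded psi1 t / psi t | t in `]r, +oo[]].

Definition interp_parameter phi0 phi1 psi : R -> R :=
  fun t => phi0 t * psi (phi1 t / phi0 t).

Definition dilation_function psi (lambda : R) : R :=
  sup [set psi (lambda * t) / psi t | t in `]0, +oo[].

End parameters.

(* Main.v *)
Require Import Defs.
From HB Require Import structures.
From mathcomp Require Import all_boot all_order all_algebra.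
From mathcomp Require Import sesquilinear complex.
From mathcomp Require Import all_classical all_reals all_analysis.
From mathcomp Require Import measurable_realfun lra ring.

Import Order.TTheory GRing.Theory Num.Theory.
Import numFieldNormedType.Exports HBNNSimple.

Local Open Scope classical_set_scope.
Local Open Scope ring_scope.
Local Open Scope complex_scope.

Set Implicit Arguments.
Unset Strict Implicit.
Unset Printing Implicit Defensive.

(* Put lam = (phi1/phi0)^2 on the side of A and lam = (eta1/eta0)^2 on the side
   of Q, and h(x) = psi(sqrt x)^2, so that the squared norms of the intermediate
   spaces are the integrals of phi0^2 h(lam) and eta0^2 h(lam) against
   <E(.)u, u>.  Since h(x) <= c^2 max(1, x/y) h(y), a minimum of finitely many
   lines through a geometric grid gives a concave piecewise linear g with
   h <= g everywhere and g <= 3 c^4 h on a prescribed interval.  Such a g is a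
   combination with nonnegative coefficients of 1, x and the functions
   min(x, sg).  For min(x, sg), split u by the spectral projection of the set
   k lam <= sg, where k = (|T|_1/|T|_0)^2, and apply T to one part in the space
   of index 0 and to the other in the space of index 1; on the side of Q the
   parallelogram law costs a factor 2.  As the image of T need not come from
   vectors of G, it is approximated in the space of index 1 by elements of
   Dom eta1(Q), at the cost of a further factor 4/3.  The product
   2 * (4/3) * 3 c^4 = 8 c^4 is the square of the constant. *)

(** * Norms, bounded linear maps and the real inner product *)

(** The two inequalities between h and g are asymmetric. On the side of Q nothing is known about
    where the image lives spectrally, so h <= g has to hold on all of (0, oo). On the side of A the
    vector can be truncated, so g only has to be comparable with h on a bounded interval, whose left
    end comes from the boundedness of phi0/phi1; this is why finitely many lines suffice. The factor
    3 is 1 + 2: on [t, 2t] the constant part of the line attached to t costs one multiple of c^4 h,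
    its linear part two. The value of k gives |T|_1^2 = k |T|_0^2, so that both parts of a cut carry
    the same factor |T|_0^2; the price is that g is evaluated at k lam, and h(k lam) is at most
    h(lam) times the squared dilation function at |T|_1/|T|_0. A separate obstacle is that the
    operators phi(A) are given by their domains and quadratic forms only: the identity between
    |phi(A)u|^2 and the integral of phi^2, on which every estimate rests, has to be recovered from
    them. *)

Section hnorm.
Context {R : realType} {V : normedModType R[i]}.
Implicit Types u v : V.

Lemma hnormE u : `|u| = (hnorm u)%:C.
Proof. by rewrite /hnorm RRe_real// ger0_real. Qed.

Lemma hnorm_ge0 u : 0 <= hnorm u.
Proof. by rewrite -ler0c -hnormE. Qed.

Lemma ler_hnormD u v : hnorm (u + v) <= hnorm u + hnorm v.
Proof. by rewrite -lecR rmorphD/= -!hnormE ler_normD. Qed.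

Lemma hnormN u : hnorm (- u) = hnorm u.
Proof. by rewrite /hnorm normrN. Qed.

Lemma ler_hnormB u v : hnorm (u - v) <= hnorm u + hnorm v.
Proof. by rewrite -[hnorm v]hnormN ler_hnormD. Qed.

Lemma hdistC u v : hnorm (u - v) = hnorm (v - u).
Proof. by rewrite -hnormN opprB. Qed.

Lemma ler_hdistD u v w : hnorm (v - w) <= hnorm (v - u) + hnorm (u - w).
Proof. by rewrite (le_trans _ (ler_hnormD _ _))// addrA subrK. Qed.

Lemma hnorm0 : hnorm (0 : V) = 0.
Proof. by rewrite /hnorm normr0. Qed.

Lemma hnorm0_eq0 u : hnorm u = 0 -> u = 0.
Proof. by move=> u0; apply/eqP; rewrite -normr_eq0 hnormE u0. Qed.

Lemma hnormZ (r : R) u : hnorm (r%:C *: u) = `|r| * hnorm u.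
Proof.
rewrite {1}/hnorm normrZ hnormE normc_def/= expr0n/= addr0 sqrtr_sqr.
by rewrite mul0r subr0.
Qed.

Lemma dense_hnorm (S : set V) : dense S ->
  forall x (d : R), 0 < d -> exists2 y, S y & hnorm (y - x) < d.
Proof.
move=> dS x d d0.
have d0c : 0 < d%:C by rewrite ltcR.
have [|y [By Sy]] := dS (ball x d%:C)^° _ (open_interior _).
  by exists x; apply: nbhsx_ballx.
exists y => //; have {}By := interior_subset By.
by rewrite hdistC -ltcR -hnormE; move: By; rewrite -ball_normE.
Qed.

End hnorm.

Section linear_maps.
Context {R : realType} {U V : normedModType R[i]}.

Lemma continuous_hnorm_bound (f : {linear U -> V}) : continuous f ->
  exists2 M : R, 0 < M & forall x, hnorm (f x) <= M * hnorm x.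
Proof.
move=> /linear_bounded_continuous/linear_boundedP/pinfty_ex_gt0[M M0 fM].
have ME : M = (complex.Re M)%:C by rewrite RRe_real// gtr0_real.
exists (complex.Re M); first by rewrite -ltcR -ME.
by move=> x; rewrite -lecR rmorphM/= -ME -!hnormE.
Qed.

Lemma hnorm_bound_continuous (f : {linear U -> V}) (M : R) :
  (forall x, hnorm (f x) <= M * hnorm x) -> continuous f.
Proof.
move=> fM; apply/linear_bounded_continuous/linear_boundedP.
exists (`|M|%:C); split; first by rewrite ger0_real// ler0c.
move=> N MN x; rewrite hnormE.
apply: (@le_trans _ _ (`|M|%:C * `|x|)); last by rewrite ler_wpM2r// ltW.
rewrite hnormE -rmorphM lecR (le_trans (fM x))// ler_wpM2r ?hnorm_ge0//.
exact: ler_norm.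
Qed.

Lemma opnorm_ge0 (f : {linear U -> V}) : 0 <= opnorm f.
Proof.
rewrite /opnorm; set A := (X in sup X).
case: (pselect (has_sup A)) => [[A0 Aub]|nA]; last by rewrite sup_out.
apply: le_trans (ub_le_sup Aub _); last first.
  by exists 0 => //=; rewrite hnorm0.
exact: hnorm_ge0.
Qed.

Lemma opnorm_bound (f : {linear U -> V}) : continuous f ->
  forall x, hnorm (f x) <= opnorm f * hnorm x.
Proof.
move=> /continuous_hnorm_bound[M M0 fM] x.
have [x0|x0] := eqVneq (hnorm x) 0.
  by have -> := hnorm0_eq0 x0; rewrite linear0 !hnorm0 mulr0.
have xgt0 : 0 < hnorm x by rewrite lt_def x0 hnorm_ge0.
rewrite -ler_pdivrMr//.
have -> : hnorm (f x) / hnorm x = hnorm (f ((hnorm x)^-1%:C *: x)).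
  by rewrite linearZ hnormZ ger0_norm ?invr_ge0 ?hnorm_ge0// mulrC.
apply: ub_le_sup; first by exists M => _ [y /= y1 <-]; rewrite (le_trans (fM y))// ler_piMr// ltW.
exists ((hnorm x)^-1%:C *: x) => //=.
by rewrite hnormZ ger0_norm ?invr_ge0 ?hnorm_ge0// mulVf.
Qed.

Lemma opnorm_le (f : {linear U -> V}) (M : R) : 0 <= M ->
  (forall x, hnorm (f x) <= M * hnorm x) -> opnorm f <= M.
Proof.
move=> M0 fM; apply: ge_sup; first by exists (hnorm (f 0)), 0 => //=; rewrite hnorm0.
by move=> _ [y /= y1 <-]; rewrite (le_trans (fM y))// ler_piMr.
Qed.

End linear_maps.

Section cauchy.
Context {R : realType} {V : completeNormedModType R[i]}.

Lemma hnorm_cauchy_cvg (u : nat -> V) :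
  (forall e : R, 0 < e -> exists N, forall m n, (N <= m)%N -> (N <= n)%N ->
     hnorm (u m - u n) < e) ->
  exists l, forall e : R, 0 < e -> exists N, forall n, (N <= n)%N ->
     hnorm (u n - l) < e.
Proof.
move=> cu.
have /cvg_ex[l ul] : cvgn u.
  apply/cauchy_cvgP/cauchy_exP => e egt0.
  have eE : e = (complex.Re e)%:C by rewrite RRe_real// gtr0_real.
  have e0 : 0 < complex.Re e by rewrite -ltcR -eE.
  have [N uN] := cu _ e0.
  exists (u N), N => //= n Nn.
  by rewrite -ball_normE /= hnormE eE ltcR; apply: uN.
exists l => e e0.
have e0c : 0 < e%:C by rewrite ltcR.
have /cvgrPdist_lt/(_ _ e0c)[N _ uN] := ul.
exists N => n Nn; rewrite hdistC -ltcR -hnormE; exact: uN.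
Qed.

End cauchy.

Section rdot.
Context {R : realType} {H : hilbertType R}.
Implicit Types u v w : H.

(** The real part is symmetric and real bilinear, so expansions of squared norms fall to [ring],
    [lra] and [nra]. *)
Definition rdot u v : R := complex.Re (dotp u v).

Lemma rdotC u v : rdot u v = rdot v u.
Proof.
rewrite /rdot hermC expr0 mul1r.
have ReJ (z : R[i]) : complex.Re (Num.conj z) = complex.Re z by case: z.
exact: ReJ.
Qed.

Lemma rdotDl u v w : rdot (u + v) w = rdot u w + rdot v w.
Proof. by rewrite /rdot linearDl raddfD. Qed.

Lemma rdotNl u w : rdot (- u) w = - rdot u w.
Proof. by rewrite /rdot linearNl raddfN. Qed.

Lemma rdotZl (r : R) u w : rdot (r%:C *: u) w = r * rdot u w.
Proof.
by rewrite /rdot linearZl_LR/=; case: (dotp u w) => a b /=; rewrite mul0r subr0.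
Qed.

Lemma rdotBl u v w : rdot (u - v) w = rdot u w - rdot v w.
Proof. by rewrite rdotDl rdotNl. Qed.

Lemma rdotDr u v w : rdot w (u + v) = rdot w u + rdot w v.
Proof. by rewrite !(rdotC w) rdotDl. Qed.

Lemma rdotNr u w : rdot w (- u) = - rdot w u.
Proof. by rewrite !(rdotC w) rdotNl. Qed.

Lemma rdotBr u v w : rdot w (u - v) = rdot w u - rdot w v.
Proof. by rewrite rdotDr rdotNr. Qed.

Lemma rdotZr (r : R) u w : rdot w (r%:C *: u) = r * rdot w u.
Proof. by rewrite !(rdotC w) rdotZl. Qed.

Lemma sqr_hnorm u : hnorm u ^+ 2 = rdot u u.
Proof.
by rewrite /rdot -dotp_normE hnormE -rmorphXn.
Qed.

Lemma rdot_hnormD u v : hnorm (u + v) ^+ 2 = hnorm u ^+ 2 + hnorm v ^+ 2 + 2 * rdot u v.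
Proof. rewrite !sqr_hnorm rdotDl !rdotDr (rdotC v u); ring. Qed.

Lemma rdot_hnormB u v : hnorm (u - v) ^+ 2 = hnorm u ^+ 2 + hnorm v ^+ 2 - 2 * rdot u v.
Proof. by rewrite rdot_hnormD hnormN rdotNr mulrN. Qed.

Lemma hnorm_parallelogram u v :
  hnorm (u + v) ^+ 2 + hnorm (u - v) ^+ 2 = 2 * (hnorm u ^+ 2 + hnorm v ^+ 2).
Proof. by rewrite rdot_hnormD rdot_hnormB; ring. Qed.

Lemma sqr_hnormD_le u v :
  hnorm (u + v) ^+ 2 <= 2 * (hnorm u ^+ 2 + hnorm v ^+ 2).
Proof. by rewrite -hnorm_parallelogram lerDl sqr_ge0. Qed.

(** Cauchy-Schwarz is read off from the norm: square the triangle inequality and compare with the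
    expansion of |u + v|^2. *)
Lemma rdot_le u v : rdot u v <= hnorm u * hnorm v.
Proof.
have := hnorm_ge0 u; have := hnorm_ge0 v; have := ler_hnormD u v.
have := rdot_hnormD u v; have := hnorm_ge0 (u + v).
by move: (hnorm (u + v)) (hnorm u) (hnorm v) (rdot u v) => a b c d; nra.
Qed.

(** If u were nonzero, some v in S would lie closer to u than |u|, and then |u|^2 = rdot u (u - v) <
    |u|^2. *)
Lemma rdot_dense_eq0 (S : set H) u : dense S ->
  (forall v, S v -> rdot u v = 0) -> u = 0.
Proof.
move=> dS uS; apply/hnorm0_eq0/eqP; rewrite eq_le hnorm_ge0 andbT.
rewrite leNgt; apply/negP => u0.
have [v Sv vu] := dense_hnorm dS u u0.
have : rdot u (u - v) <= hnorm u * hnorm (u - v) := rdot_le _ _.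
rewrite rdotBr (uS _ Sv) subr0 -sqr_hnorm expr2 ler_pM2l// hdistC.
by rewrite leNgt vu.
Qed.

End rdot.

(** * Spectral measures *)

Section measurable_comparison.
Context {d} {T : measurableType d} {R : realType}.
Variables (D : set T) (f g : T -> R).
Hypotheses (mD : measurable D) (mf : measurable_fun D f) (mg : measurable_fun D g).

Lemma measurable_lt_set : measurable (D `&` [set t | f t < g t]).
Proof.
rewrite (_ : [set t | _] = (fun t => f t < g t) @^-1` [set true]).
  exact: measurable_fun_ltr.
by apply/seteqP; split.
Qed.

Lemma measurable_le_set : measurable (D `&` [set t | f t <= g t]).
Proof.
rewrite (_ : [set t | _] = (fun t => f t <= g t) @^-1` [set true]).
  exact: measurable_fun_ler.
by apply/seteqP; split.
Qed.

End measurable_comparison.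

Section measure_comparison.
Context {d} {T : measurableType d} {R : realType}.
Variables (mu nu : {measure set T -> \bar R}) (D : set T) (f : T -> \bar R).
Hypotheses (mD : measurable D) (mf : measurable_fun D f)
  (f0 : forall t, D t -> (0 <= f t)%E).

(** Serves for [mu] the spectral measure of u and [nu] that of [E B u], or that of [u - E B u] with
    B replaced by its complement. *)
Lemma integral_measure_concentrated (B : set T) : measurable B ->
  (forall C, measurable C -> C `<=` B -> nu C = mu C) ->
  (forall C, measurable C -> C `<=` ~` B -> nu C = 0%E) ->
  (\int[nu]_(t in D) f t = \int[mu]_(t in D `&` B) f t)%E.
Proof.
move=> mB nuB nu0.
rewrite -{1}(setUIDK D B) setUC ge0_integral_setU//; first last.
- by apply/disj_setPS => t [[_ nBt] [_ Bt]].
- by rewrite setUC setUIDK.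
- by rewrite setUC setUIDK.
- exact: measurableI.
- exact: measurableD.
rewrite (eq_measure_integral mzero) => [|C mC CB]; last first.
  by rewrite nu0// => t /CB[].
rewrite integral_measure_zero add0e.
by apply: eq_measure_integral => C mC CB; rewrite nuB// => t /CB[].
Qed.

Lemma le_measure_integral :
  (forall C, measurable C -> (nu C <= mu C)%E) ->
  (\int[nu]_(t in D) f t <= \int[mu]_(t in D) f t)%E.
Proof.
move=> numu; rewrite [leLHS]integral_mkcond [leRHS]integral_mkcond.
apply: ge0_le_measure_integral => //.
- by move=> t; apply: erestrict_ge0.
- exact/(measurable_restrictT _ mD).
Qed.

End measure_comparison.

Section proj_measure_theory.
Context {R : realType} {H : hilbertType R} (E : proj_measure H).
Implicit Types (u v : H) (B C : set (measurableTypeR R)).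

Lemma pm_proj_sym B u v : measurable B -> rdot (E B u) v = rdot u (E B v).
Proof. by move=> mB; rewrite /rdot pm_sym. Qed.

Lemma pm_projK B u : measurable B -> E B (E B u) = E B u.
Proof. by move=> mB; rewrite -pm_setI// setIid. Qed.

Lemma rdot_pm_proj B u : measurable B -> rdot (E B u) u = hnorm (E B u) ^+ 2.
Proof. by move=> mB; rewrite sqr_hnorm -pm_proj_sym// pm_projK. Qed.

(* Unlike [spectral_distr E u], this is nonnegative on non-measurable sets too. *)
Definition spectral_measure u B : \bar R := (hnorm (E B u) ^+ 2)%:E.

Lemma spectral_measureE u B : measurable B ->
  spectral_distr E u B = spectral_measure u B.
Proof. by move=> mB; rewrite /spectral_measure -rdot_pm_proj. Qed.

Let spectral_measure_ge0 u B : (0 <= spectral_measure u B)%E.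
Proof. by rewrite lee_fin sqr_ge0. Qed.

Let spectral_measure_sigma_additive u : semi_sigma_additive (spectral_measure u).
Proof.
move=> F mF tF mUF; rewrite -spectral_measureE//.
rewrite (_ : (fun n => _) = (fun n => \sum_(0 <= i < n) spectral_distr E u (F i))%E).
  exact: pm_sigma_additive.
by apply/funext => n; apply: eq_bigr => i _; rewrite spectral_measureE.
Qed.

(** Countable additivity for a sequence of empty sets says that n x tends to x; shifting the index
    gives x = x + x. *)
Let spectral_measure0 u : spectral_measure u set0 = 0%E.
Proof.
have tr0 : trivIset [set: nat] (fun=> set0 : set (measurableTypeR R)).
  by move=> i j _ _ [x []].
have := @spectral_measure_sigma_additive u (fun=> set0) (fun=> measurable0)
  tr0 (bigcup_measurable (fun _ _ => measurable0)).
rewrite bigcup0// /spectral_measure; set x := hnorm _ ^+ 2.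
rewrite (_ : (fun n => _) = EFin \o (fun n => n%:R * x)); last first.
  apply/funext => n /=; rewrite sumEFin; congr EFin.
  by rewrite sumr_const_nat subn0 mulr_natl.
move=> /fine_cvgP[_] /= h; congr EFin.
have h1 : (fun n => n.+1%:R * x) @ \oo --> x.
  by rewrite (cvg_shiftS (fun n => n%:R * x)).
have h2 : (fun n => n.+1%:R * x) @ \oo --> x + x.
  rewrite (_ : (fun n => _) = (fun n => n%:R * x) \+ cst x).
    by apply: cvgD => //; apply: cvg_cst.
  by apply/funext => n /=; rewrite -natr1 mulrDl mul1r.
have xx : x = x + x := cvg_unique _ h1 h2.
by apply: (addrI x); rewrite addr0 -xx.
Qed.

HB.instance Definition _ u := isMeasure.Build _ _ _ (spectral_measure u)
  (spectral_measure0 u) (spectral_measure_ge0 u)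
  (@spectral_measure_sigma_additive u).

(** [integral] makes sense for any set function, as a supremum over simple functions; their level
    sets are measurable, and there the two set functions agree. *)
Lemma integral_spectral_distr D f u :
  (\int[spectral_distr E u]_(t in D) f t = \int[spectral_measure u]_(t in D) f t)%E.
Proof.
have sE (h : {nnsfun measurableTypeR R >-> R}) :
    sintegral (spectral_distr E u) h = sintegral (spectral_measure u) h.
  by apply: eq_fsbigr => x _; rewrite spectral_measureE.
by rewrite /integral; congr (ereal_sup _ - ereal_sup _)%E;
  rewrite eqEsubset; split=> _ [h hf <-]; exists h.
Qed.

Lemma pm_proj0 u : E set0 u = 0.
Proof.
apply/hnorm0_eq0/eqP; rewrite -(sqrf_eq0 (hnorm _)); apply/eqP.
by have [] : spectral_measure u set0 = 0%E by exact: measure0.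
Qed.

Lemma spectral_measure_fin u B : (spectral_measure u B < +oo)%E.
Proof. by rewrite ltry. Qed.

Lemma spectral_measureT u : spectral_measure u setT = (hnorm u ^+ 2)%:E.
Proof. by rewrite /spectral_measure pm_setT. Qed.

Lemma integral_spectral_measure_proj D B f u : measurable D -> measurable B ->
  measurable_fun D f -> (forall t, D t -> (0 <= f t)%E) ->
  (\int[spectral_measure (E B u)]_(t in D) f t =
   \int[spectral_measure u]_(t in D `&` B) f t)%E.
Proof.
move=> mD mB mf f0; apply: integral_measure_concentrated => // C mC CB.
  by rewrite /= /spectral_measure -pm_setI// setIidl.
rewrite /= /spectral_measure -pm_setI// (_ : C `&` B = set0); last by rewrite disjoints_subset.
by rewrite pm_proj0 hnorm0 expr0n.
Qed.

Lemma integral_spectral_measure_projC D B f u : measurable D -> measurable B ->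
  measurable_fun D f -> (forall t, D t -> (0 <= f t)%E) ->
  (\int[spectral_measure (u - E B u)%R]_(t in D) f t =
   \int[spectral_measure u]_(t in D `\` B) f t)%E.
Proof.
move=> mD mB mf f0; rewrite setDE.
apply: integral_measure_concentrated => // [|C mC CB|C mC].
- exact: measurableC.
- rewrite /= /spectral_measure linearB/= -pm_setI//.
  rewrite (_ : C `&` B = set0); last by rewrite disjoints_subset.
  by rewrite pm_proj0 subr0.
- rewrite setCK => CB.
  by rewrite /= /spectral_measure linearB/= -pm_setI// setIidl// subrr hnorm0 expr0n.
Qed.

(** The parallelogram law for [E C u] and [E C v] dominates one measure by twice the sum of the
    others, set by set. *)
Lemma integral_spectral_measureD_le D f u v : measurable D ->
  measurable_fun D f -> (forall t, D t -> (0 <= f t)%E) ->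
  (\int[spectral_measure (u + v)%R]_(t in D) f t <=
   2%:E * (\int[spectral_measure u]_(t in D) f t +
           \int[spectral_measure v]_(t in D) f t))%E.
Proof.
move=> mD mf f0.
have two0 : (0 <= 2 :> R) by [].
rewrite -ge0_integral_measure_add//.
rewrite -(ge0_integral_mscale _ mD (NngNum two0) mf)//.
apply: le_measure_integral => // C mC.
rewrite [leRHS](_ : _ = 2%:E * (spectral_measure u C + spectral_measure v C))%E;
  last by rewrite -(measure_addE (spectral_measure u) (spectral_measure v)).
rewrite /= /spectral_measure.
by rewrite -EFinD -EFinM lee_fin linearD sqr_hnormD_le.
Qed.

End proj_measure_theory.

(** * Integrals with respect to a projection-valued measure *)

Section linop_theory.
Context {R : realType} {H : hilbertType R} (P : linop H).
Implicit Types u v : H.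

Lemma linop_domD u v : dom P u -> dom P v -> dom P (u + v).
Proof. by move=> Pu Pv; rewrite -[u]scale1r; exact: domP. Qed.

Lemma linop_domZ (a : R[i]) u : dom P u -> dom P (a *: u).
Proof. by move=> Pu; rewrite -[_ *: _]addr0; apply: domP => //; exact: dom0. Qed.

Lemma linop_domN u : dom P u -> dom P (- u).
Proof. by move=> Pu; rewrite -scaleN1r; exact: linop_domZ. Qed.

Lemma linop_domB u v : dom P u -> dom P v -> dom P (u - v).
Proof. by move=> Pu Pv; apply: linop_domD => //; exact: linop_domN. Qed.

Lemma linop_actD u v : dom P u -> dom P v -> P (u + v) = P u + P v.
Proof. by move=> Pu Pv; rewrite -[u]scale1r act_linear// !scale1r. Qed.

Lemma linop_act0 : P 0 = 0.
Proof. by apply: (addrI (P 0)); rewrite -linop_actD ?addr0//; exact: dom0. Qed.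

Lemma linop_actZ (a : R[i]) u : dom P u -> P (a *: u) = a *: P u.
Proof.
by move=> Pu; rewrite -[_ *: u]addr0 act_linear// ?linop_act0 ?addr0//; exact: dom0.
Qed.

Lemma linop_actB u v : dom P u -> dom P v -> P (u - v) = P u - P v.
Proof.
move=> Pu Pv; rewrite linop_actD//; last exact: linop_domN.
by rewrite -scaleN1r linop_actZ// scaleN1r.
Qed.

Hypothesis P_real : forall u, dom P u -> complex.Im (dotp (P u) u) = 0.

(** The form is real at u + i v, and the imaginary part of its cross terms is
    [rdot (P v) u - rdot (P u) v]. *)
Lemma linop_sym u v : dom P u -> dom P v -> rdot (P u) v = rdot (P v) u.
Proof.
move=> Pu Pv.
have Piv : dom P ('i%C *: v) by exact: linop_domZ.
have := P_real (linop_domD Pu Piv).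
rewrite linop_actD// linop_actZ// !linearDl !linearDr.
rewrite !linearZl_LR !linearZr_LR /= !raddfD/=.
have ImJ (z : R[i]) : complex.Im (Num.conj 'i%C * z)%R = - complex.Re z.
  have -> : Num.conj 'i%C = - 'i%C :> R[i] by apply/eqP; rewrite eq_complex/= oppr0 !eqxx.
  by case: z => x y /=; rewrite oppr0 mul0r mulN1r add0r.
have Imi (z : R[i]) : complex.Im ('i%C * z)%R = complex.Re z.
  by case: z => x y /=; rewrite mul0r mul1r add0r.
have Rei (z : R[i]) : complex.Re ('i%C * z)%R = - complex.Im z.
  by case: z => x y /=; rewrite mul0r mul1r sub0r.
rewrite -[_ *: _]/(_ * _)%R !ImJ Imi Rei !P_real// opprK addr0 add0r /rdot.
by move=> h; lra.
Qed.

Lemma rdot_polarization u v : dom P u -> dom P v ->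
  4 * rdot (P u) v = rdot (P (u + v)) (u + v) - rdot (P (u - v)) (u - v).
Proof.
move=> Pu Pv; rewrite linop_actD// linop_actB// !rdotDl !rdotDr !rdotNl !rdotNr.
by rewrite (linop_sym Pv Pu); ring.
Qed.

End linop_theory.

Section proj_limit.
Context {R : realType} {H : hilbertType R} (E : proj_measure H).
Implicit Types (u v : H).

(** Additivity is given for the spectral distributions rather than for the operators, hence the
    detour through the integral of 1. *)
Lemma sqr_hnorm_projC (B : set (measurableTypeR R)) u : measurable B ->
  hnorm (u - E B u) ^+ 2 = hnorm (E (~` B) u) ^+ 2.
Proof.
move=> mB; apply: EFin_inj.
rewrite -[RHS]/(spectral_measure E u (~` B)) -(spectral_measureT E).
rewrite -[LHS]mul1e -[RHS]mul1e -!integral_cst//; last exact: measurableC.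
by rewrite integral_spectral_measure_projC// setTD.
Qed.

(** The squared error is the spectral measure of the complement of [W n]; these sets decrease to the
    empty set and the measure is finite. *)
Lemma pm_proj_cvg (W : nat -> set (measurableTypeR R)) u :
  (forall n, measurable (W n)) -> nondecreasing_seq W -> \bigcup_n W n = setT ->
  forall e : R, 0 < e -> exists n, hnorm (u - E (W n) u) < e.
Proof.
move=> mW ndW UW e e0.
have mWC n : measurable (~` W n) by exact: measurableC.
have capW : \bigcap_n ~` W n = set0 by rewrite -setC_bigcup UW setCT.
have ndWC : nonincreasing_seq (fun n => ~` W n).
  by move=> m n mn; apply/subsetPset/subsetC/subsetPset/ndW.
have := @nonincreasing_cvg_mu _ _ _ (spectral_measure E u) (fun n => ~` W n).
rewrite capW => /(_ (ltry _) mWC measurable0 ndWC).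
rewrite measure0 => /fine_cvgP[_] /cvgrPdist_lt/(_ _ (exprn_gt0 2 e0))[n _].
move=> /(_ n (leqnn n))/=; rewrite sub0r normrN -sqr_hnorm_projC//.
rewrite /= ger0_norm ?sqr_ge0// => he; exists n.
by rewrite -(ltr_pXn2r (n:=2))// nnegrE ?hnorm_ge0// ltW.
Qed.

End proj_limit.

(** * From the quadratic form of a spectral integral to its norm *)

Section spectral_integral.
Context {R : realType} {H : hilbertType R} (E : proj_measure H).
Variables (D : set (measurableTypeR R)) (f : measurableTypeR R -> R) (P : linop H).
Hypotheses (mD : measurable D) (mf : measurable_fun D f)
  (f_gt0 : forall t, D t -> 0 < f t) (PP : is_spectral_integral E D f P).
Implicit Types (u v : H) (B : set (measurableTypeR R)).

Let mfE : measurable_fun D (EFin \o f).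
Proof. exact/measurable_EFinP. Qed.

Let mf2E : measurable_fun D (EFin \o (fun t => f t ^+ 2)).
Proof. by apply/measurable_EFinP; apply: measurable_funX. Qed.

Let f0E t : D t -> (0 <= (f t)%:E)%E.
Proof. by move=> Dt; rewrite lee_fin ltW// f_gt0. Qed.

Let f20E t : D t -> (0 <= (f t ^+ 2)%:E)%E.
Proof. by move=> Dt; rewrite lee_fin sqr_ge0. Qed.

Lemma spectral_integral_domE u :
  dom P u <-> (\int[spectral_measure E u]_(t in D) (f t ^+ 2)%:E < +oo)%E.
Proof. by rewrite PP.1 /= integral_spectral_distr. Qed.

Let fin_int_f u : dom P u ->
  (\int[spectral_measure E u]_(t in D) (f t)%:E < +oo)%E.
Proof.
move=> /spectral_integral_domE fu.
apply: (@le_lt_trans _ _ (\int[spectral_measure E u]_(t in D) (1%:E + (f t ^+ 2)%:E))%E).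
  apply: ge0_le_integral => //.
  - by apply: emeasurable_funD.
  - move=> t Dt; rewrite -EFinD lee_fin; nra.
rewrite ge0_integralD//.
by rewrite integral_cst// mul1e lte_add_pinfty// spectral_measure_fin.
Qed.

Lemma spectral_integral_formE u : dom P u ->
  (\int[spectral_measure E u]_(t in D) (f t)%:E = (rdot (P u) u)%:E)%E.
Proof.
move=> Pu; rewrite /rdot (PP.2 _ Pu) integral_spectral_distr/= fineK//.
by rewrite ge0_fin_numE ?fin_int_f// integral_ge0.
Qed.

Let P_real u : dom P u -> complex.Im (dotp (P u) u) = 0.
Proof. by move=> /PP.2 ->. Qed.

Lemma spectral_integral_dom_proj B u : measurable B -> dom P u -> dom P (E B u).
Proof.
move=> mB /spectral_integral_domE fu; apply/spectral_integral_domE.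
rewrite integral_spectral_measure_proj//; apply: le_lt_trans fu.
by apply: ge0_subset_integral => //; exact: measurableI.
Qed.

Lemma spectral_integral_dom_bounded B (M : R) u : measurable B ->
  (forall t, D t -> B t -> f t <= M) -> dom P (E B u).
Proof.
move=> mB fM; apply/spectral_integral_domE.
have mDB : measurable (D `&` B) by exact: measurableI.
rewrite integral_spectral_measure_proj//.
apply: (@le_lt_trans _ _ (\int[spectral_measure E u]_(t in D `&` B) (M ^+ 2)%:E)%E).
  apply: ge0_le_integral => //.
  - by move=> t [/f20E].
  - exact: measurable_funS mf2E.
  - by move=> t [Dt Bt]; rewrite lee_fin lerXn2r ?nnegrE ?fM// ?(le_trans _ (fM _ Dt Bt))// ltW// f_gt0.
by rewrite integral_cst// -EFinM ltry.
Qed.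

(** Projecting onto the set where f exceeds n nowhere on D lands in the domain, and these
    projections converge strongly to the identity. *)
Lemma spectral_integral_dense : dense (dom P).
Proof.
move=> O [v Ov] oO; rewrite /=.
have [_/posnumP[e] eO] : exists2 e : R[i], 0 < e & ball v e `<=` O.
  by have [e e0 eO] := (nbhs_ballP v O).1 (open_nbhs_nbhs (conj oO Ov)); exists e.
have ecE : e%:num = (complex.Re e%:num)%:C by rewrite RRe_real.
have e0 : 0 < complex.Re e%:num by rewrite -ltcR -ecE; exact: gt0.
pose A (n : nat) := D `&` [set t | n%:R < f t].
have mA n : measurable (A n) by apply: measurable_lt_set => //; exact: measurable_cst.
have mAC n : measurable (~` A n) by exact: measurableC.
have [//|||n vn] := @pm_proj_cvg _ _ E (fun n => ~` A n) v _ _ _ _ e0.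
- move=> m n mn; apply/subsetPset/subsetC => t [Dt nt].
  by split => //=; rewrite (le_lt_trans _ nt)// ler_nat.
- apply/seteqP; split => // t _; exists (Num.truncn (f t)).+1 => //= -[Dt] /=.
  by move=> /(lt_trans (truncnS_gt _)); rewrite ltxx.
exists (E (~` A n) v); split.
  by apply: eO; rewrite -ball_normE /= hnormE ecE ltcR.
apply: (@spectral_integral_dom_bounded _ n%:R) => // t Dt /not_andP[//|] /=.
by move=> /negP; rewrite -leNgt.
Qed.

(* [P] commutes with [E B] because, on the orthogonal ranges of [E B] and
   [1 - E B], the form of [P] takes the same value at [a + b] and [a - b]. *)
Lemma spectral_integral_comm B u : measurable B -> dom P u -> E B (P u) = P (E B u).
Proof.
move=> mB Pu.
have formN a b : dom P a -> dom P b -> E B a = a -> E B b = 0 -> rdot (P a) b = 0.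
  move=> Pa Pb aB bB.
  suff h : rdot (P (a + b)) (a + b) = rdot (P (a - b)) (a - b).
    by have := rdot_polarization P_real Pa Pb; rewrite h subrr; lra.
  apply/EFin_inj; rewrite -!spectral_integral_formE//; [|exact: linop_domB|exact: linop_domD].
  apply: eq_measure_integral => C mC _.
  have ab0 : rdot (E C a) (E C b) = 0.
    rewrite pm_proj_sym// pm_projK// -aB pm_proj_sym// -pm_setI// setIC pm_setI// bB linear0.
    by rewrite /rdot linear0r.
  by rewrite /= /spectral_measure linearD linearB/= rdot_hnormD rdot_hnormB ab0 mulr0 addr0 subr0.
apply/eqP; rewrite -subr_eq0; apply/eqP.
apply: (rdot_dense_eq0 spectral_integral_dense) => v Pv.
have PBu := spectral_integral_dom_proj mB Pu.
have PBv := spectral_integral_dom_proj mB Pv.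
(* By [h1] and [h2], the products of [E B (P u)] and of [P (E B u)] with v both equal that of
   [P (E B u)] with [E B v]. *)
have h1 : rdot (P (E B u)) (v - E B v) = 0.
  apply: formN => //; first exact: linop_domB.
    exact: pm_projK.
  by rewrite linearB/= pm_projK// subrr.
have h2 : rdot (P (u - E B u)) (E B v) = 0.
  rewrite linop_sym//; last exact: linop_domB.
  apply: formN => //; first exact: linop_domB.
    exact: pm_projK.
  by rewrite linearB/= pm_projK// subrr.
rewrite rdotBl pm_proj_sym//.
move: h1 h2; rewrite linop_actB// rdotBl rdotBr; lra.
Qed.

Let form_ge0 u : dom P u -> 0 <= rdot (P u) u.
Proof. by move=> Pu; rewrite -lee_fin -spectral_integral_formE// integral_ge0. Qed.

Let form_proj B u : measurable B -> dom P u ->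
  ((rdot (P (E B u)) (E B u))%:E =
   \int[spectral_measure E u]_(t in D `&` B) (f t)%:E)%E.
Proof.
move=> mB Pu; rewrite -spectral_integral_formE//; last exact: spectral_integral_dom_proj.
by rewrite integral_spectral_measure_proj.
Qed.

Let form_le B u (b : R) : measurable B -> 0 <= b ->
  (forall t, D t -> B t -> f t <= b) -> dom P (E B u) ->
  rdot (P (E B u)) (E B u) <= b * hnorm (E B u) ^+ 2.
Proof.
move=> mB b0 fb Pu; have mDB : measurable (D `&` B) by exact: measurableI.
have := form_proj mB Pu; rewrite pm_projK// => h; rewrite -lee_fin h.
apply: (@le_trans _ _ (\int[spectral_measure E (E B u)]_(t in D `&` B) b%:E)%E).
  apply: ge0_le_integral => //.
  - by move=> t [/f0E].
  - exact: measurable_funS mfE.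
  - by move=> t [Dt Bt]; rewrite lee_fin fb.
rewrite integral_cst// EFinM lee_wpmul2l// -(spectral_measureT E).
by rewrite le_measure// inE.
Qed.

Let form_ge B u (a : R) : measurable B -> B `<=` D -> 0 <= a ->
  (forall t, B t -> a <= f t) -> dom P (E B u) ->
  a * hnorm (E B u) ^+ 2 <= rdot (P (E B u)) (E B u).
Proof.
move=> mB BD a0 fa Pu.
have := form_proj mB Pu; rewrite pm_projK// setIidr// => h; rewrite -lee_fin h.
apply: (@le_trans _ _ (\int[spectral_measure E (E B u)]_(t in B) a%:E)%E); last first.
  by apply: ge0_le_integral => //; exact: measurable_funS mfE.
rewrite integral_cst// EFinM lee_wpmul2l//.
by rewrite /= /spectral_measure pm_projK.
Qed.

(* Nonnegativity of the form at [w - b^-1 P w], where [w = E B u]. *)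
Let proj_act_le B u (b : R) : measurable B -> 0 < b ->
  (forall t, D t -> B t -> f t <= b) -> dom P u ->
  hnorm (E B (P u)) ^+ 2 <= b * rdot (P (E B u)) (E B u).
Proof.
move=> mB b0 fb Pu; rewrite spectral_integral_comm//.
have Pw := spectral_integral_dom_proj mB Pu.
have PPw : dom P (P (E B u)).
  by rewrite -spectral_integral_comm//; exact: spectral_integral_dom_bounded fb.
have bP : rdot (P (P (E B u))) (P (E B u)) <= b * hnorm (P (E B u)) ^+ 2.
  by rewrite -spectral_integral_comm//; apply: form_le => //; [exact: ltW|rewrite spectral_integral_comm].
set w := E B u in Pw PPw bP *.
have := form_ge0 (linop_domB Pw (linop_domZ (b^-1%:C) PPw)).
rewrite linop_actB//; last exact: linop_domZ.
rewrite linop_actZ// !rdotBl !rdotBr !rdotZl !rdotZr (linop_sym P_real PPw Pw).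
move: bP; rewrite !sqr_hnorm.
set x := rdot (P w) w; set y := rdot (P w) (P w); set z := rdot (P (P w)) (P w).
move=> zy h.
have : b^-1 * (b^-1 * z) <= b^-1 * y.
  by rewrite ler_pM2l ?invr_gt0// mulrC ler_pdivrMr// mulrC.
move: h => /[swap] h1 h2.
have : b^-1 * y <= x by lra.
by rewrite mulrC ler_pdivrMr// mulrC.
Qed.

(* Nonnegativity of [|P w - a w|^2], where [w = E B u]. *)
Let proj_act_ge B u (a : R) : measurable B -> B `<=` D -> 0 <= a ->
  (forall t, B t -> a <= f t) -> dom P u ->
  a * rdot (P (E B u)) (E B u) <= hnorm (E B (P u)) ^+ 2.
Proof.
move=> mB BD a0 fa Pu; rewrite spectral_integral_comm//.
have Pw := spectral_integral_dom_proj mB Pu.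
have aP := form_ge mB BD a0 fa Pw.
have := sqr_ge0 (hnorm (P (E B u) - a%:C *: E B u)).
rewrite rdot_hnormB rdotZr hnormZ exprMn real_normK ?num_real//.
move: aP; move: (hnorm _ ^+ 2) (hnorm _ ^+ 2) (rdot _ _) => x y z; nra.
Qed.

(** With q the integral of f over B, both |E B (P u)|^2 and the integral of f^2 over B lie between a
    q and (a + e) q, so they differ by at most e q. *)
Let proj_act_cell B u (a e : R) : measurable B -> B `<=` D -> 0 <= a -> 0 < e ->
  (forall t, B t -> a <= f t <= a + e) -> dom P u ->
  ((hnorm (E B (P u)) ^+ 2)%:E <= \int[spectral_measure E u]_(t in B) (f t ^+ 2)%:E
      + e%:E * \int[spectral_measure E u]_(t in B) (f t)%:E)%E /\
  (\int[spectral_measure E u]_(t in B) (f t ^+ 2)%:E <= (hnorm (E B (P u)) ^+ 2)%:E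
      + e%:E * \int[spectral_measure E u]_(t in B) (f t)%:E)%E.
Proof.
move=> mB BD a0 e0 fa Pu.
have ae0 : 0 < a + e by rewrite ltr_wpDl.
have mfB : measurable_fun B (EFin \o f) := measurable_funS mD BD mfE.
have mf2B : measurable_fun B (EFin \o (fun t => f t ^+ 2)) := measurable_funS mD BD mf2E.
have f0B t : B t -> (0 <= (f t)%:E)%E by move=> /BD/f0E.
have f20B t : B t -> (0 <= (f t ^+ 2)%:E)%E by move=> /BD/f20E.
have h1 : hnorm (E B (P u)) ^+ 2 <= (a + e) * rdot (P (E B u)) (E B u).
  by apply: proj_act_le => // t _ /fa/andP[].
have h2 : a * rdot (P (E B u)) (E B u) <= hnorm (E B (P u)) ^+ 2.
  by apply: proj_act_ge => // t /fa/andP[].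
have hf := form_proj mB Pu; rewrite setIidr// in hf.
rewrite -hf; split.
  apply: (@le_trans _ _ ((a + e) * rdot (P (E B u)) (E B u))%:E); first by rewrite lee_fin.
  rewrite mulrDl EFinD !EFinM leeD2r// hf -ge0_integralZl//; last first.
  apply: ge0_le_integral => //.
  - by move=> t Bt; apply: mule_ge0 => //; exact: f0B.
  - exact: measurable_funeM.
  - move=> t Bt; rewrite -EFinM lee_fin expr2 ler_wpM2r//; last by case/andP: (fa _ Bt).
    by rewrite -lee_fin; exact: f0B.
apply: (@le_trans _ _ ((a + e) * rdot (P (E B u)) (E B u))%:E); last first.
  by rewrite mulrDl EFinD EFinM leeD2r// lee_fin.
rewrite EFinM hf -ge0_integralZl//; last by rewrite lee_fin ltW.
apply: ge0_le_integral => //.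
- exact: measurable_funeM.
- move=> t Bt; rewrite -EFinM lee_fin expr2 ler_wpM2r//; last by case/andP: (fa _ Bt).
  by rewrite -lee_fin; exact: f0B.
Qed.

(** D is cut into the cells where f lies in [k e, (k + 1) e). Summing [proj_act_cell] gives a total
    error of e times the integral of f over D, which is finite, and e is arbitrary. *)
Lemma spectral_integral_hnorm u : dom P u ->
  ((hnorm (P u) ^+ 2)%:E = \int[spectral_measure E u]_(t in D) (f t ^+ 2)%:E)%E.
Proof.
move=> Pu.
(* [P u] has no component off D: there the upper bound on f holds vacuously, and the form is an
   integral over the empty set. *)
have suppD : ((hnorm (P u) ^+ 2)%:E = spectral_measure E (P u) D).
  have mDC : measurable (~` D) by exact: measurableC.
  rewrite -(spectral_measureT E) -(setUv D) measureU ?setICr//.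
  rewrite [X in (_ + X)%E](_ : _ = 0%E) ?adde0//.
  rewrite /= /spectral_measure; congr EFin; apply/eqP.
  rewrite eq_le sqr_ge0 andbT.
  have h := @proj_act_le (~` D) u 1 mDC ltr01 (fun t Dt nDt => False_ind _ (nDt Dt)) Pu.
  apply: (le_trans h); rewrite mul1r -lee_fin form_proj// setICr.
  by rewrite integral_set0.
rewrite suppD.
suff approx (e : R) : 0 < e ->
    (spectral_measure E (P u) D <= \int[spectral_measure E u]_(t in D) (f t ^+ 2)%:E
      + e%:E * \int[spectral_measure E u]_(t in D) (f t)%:E)%E /\
    (\int[spectral_measure E u]_(t in D) (f t ^+ 2)%:E <= spectral_measure E (P u) D
      + e%:E * \int[spectral_measure E u]_(t in D) (f t)%:E)%E.
  have small x y : (forall e : R, 0 < e ->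
      (x <= y + e%:E * \int[spectral_measure E u]_(t in D) (f t)%:E)%E) -> (x <= y)%E.
    move=> xy; apply/lee_addgt0Pr => e e0.
    rewrite spectral_integral_formE// in xy.
    have := form_ge0 Pu; move: (rdot _ _) xy => q xy q0.
    apply: (le_trans (xy (e / (q + 1)) _)); first by rewrite divr_gt0// ltr_wpDl.
    rewrite leeD2l// -EFinM lee_fin mulrAC ler_pdivrMr ?ltr_wpDl//.
    by rewrite ler_pM2l// lerDl.
  by apply/eqP; rewrite eq_le; apply/andP; split; apply: small => e /approx[].
move=> e0.
pose B k := (D `&` [set t | k%:R * e <= f t]) `&` (D `&` [set t | f t < k.+1%:R * e]).
have mB k : measurable (B k).
  by apply: measurableI; [apply: measurable_le_set|apply: measurable_lt_set] => //;
    exact: measurable_cst.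
have BE k t : B k t <-> D t /\ Num.truncn (f t / e) = k.
  split=> [[[Dt /= h1] [_ /= h2]]|[Dt <-]].
    by split => //; apply: truncn_def; rewrite ler_pdivlMr// ltr_pdivrMr// h1.
  have /truncn_itv : 0 <= f t / e by rewrite divr_ge0// ltW// f_gt0.
  by rewrite ler_pdivlMr// ltr_pdivrMr// => /andP[h1 h2].
have BD k : B k `<=` D by move=> t /BE[].
have Bcell k t : B k t -> k%:R * e <= f t <= k%:R * e + e.
  by move=> [[_ /= h1] [_ /= h2]]; move: h2; rewrite h1 -natr1 mulrDl mul1r => /ltW.
have UB : \bigcup_k B k = D.
  apply/seteqP; split=> [t [k _ /BD]//|t Dt].
  by exists (Num.truncn (f t / e)) => //; exact/BE.
have tB : trivIset setT B by move=> i j _ _ [t [/BE[_ <-] /BE[_ <-]]].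
have cell k : _ /\ _ := @proj_act_cell (B k) u (k%:R * e) e (mB k) (BD k)
  (mulr_ge0 (ler0n _ _) (ltW e0)) e0 (Bcell k) Pu.
have sumf (g : R -> \bar R) : measurable_fun D g -> (forall t, D t -> 0 <= g t)%E ->
    (\int[spectral_measure E u]_(t in D) g t =
     \sum_(0 <= k <oo) \int[spectral_measure E u]_(t in B k) g t)%E.
  by move=> mg g0; rewrite -{1}UB ge0_integral_bigcup// ?UB.
have mfB k : measurable_fun (B k) (EFin \o f) := measurable_funS mD (BD k) mfE.
have I0 k : (0 <= \int[spectral_measure E u]_(t in B k) (f t)%:E)%E.
  by apply: integral_ge0 => t /BD/f0E.
have I20 k : (0 <= \int[spectral_measure E u]_(t in B k) (f t ^+ 2)%:E)%E.
  by apply: integral_ge0 => t /BD/f20E.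
have e0E : (0 <= e%:E)%E by rewrite lee_fin ltW.
have -> : spectral_measure E (P u) D =
    (\sum_(0 <= k <oo) spectral_measure E (P u) (B k))%E.
  by rewrite -[in LHS]UB measure_semi_bigcup// UB.
rewrite (sumf (fun t => (f t)%:E))// (sumf (fun t => (f t ^+ 2)%:E))//.
rewrite -nneseriesZl//.
have eI0 k : (0 <= k)%N -> true ->
    (0 <= e%:E * \int[spectral_measure E u]_(t in B k) (f t)%:E)%E.
  by move=> _ _; exact: mule_ge0.
rewrite -!nneseriesD//.
by split; apply: lee_nneseries => // k _; case: (cell k).
Qed.

End spectral_integral.

(** * Piecewise linear concave majorants *)

Section concave_majorant.
Context {R : realType}.
Implicit Types (al be a b x y : R) (s : seq (R * R)).

(* Piecewise linear concave functions as combinations of [1], [x] and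
   [min x sg], the functions for which interpolation only needs the cut at [sg]. *)
Definition cpl al be s x : R := al + be * x + \sum_(p <- s) p.1 * Num.min x p.2.

Definition nneg_pairs s : bool := all (fun p => (0 <= p.1) && (0 <= p.2)) s.

Lemma cpl_cons al be p s x : cpl al be (p :: s) x = p.1 * Num.min x p.2 + cpl al be s x.
Proof. by rewrite /cpl big_cons addrCA. Qed.

Lemma continuous_cpl al be s : continuous (cpl al be s).
Proof.
elim: s => [|p s IHs] x.
  rewrite (_ : cpl al be [::] = fun x => al + be * x); last first.
    by apply/funext => y; rewrite /cpl big_nil addr0.
  by apply: cvgD; [exact: cvg_cst|apply: cvgM; [exact: cvg_cst|exact: cvg_id]].
rewrite (_ : cpl al be _ = fun x => p.1 * Num.min x p.2 + cpl al be s x); last first.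
  by apply/funext => y; rewrite cpl_cons.
apply: cvgD; last exact: IHs.
apply: cvgM; first exact: cvg_cst.
by apply: (@continuous_min _ _ id (cst p.2)); [exact: cvg_id|exact: cvg_cst].
Qed.

(** Each [min x p.2] is nondecreasing, so [be] is the least slope, the one at infinity. *)
Lemma cpl_incr al be s x y : nneg_pairs s -> x <= y ->
  be * (y - x) <= cpl al be s y - cpl al be s x.
Proof.
move=> + xy; elim: s => [|p s IHs] /=.
  by move=> _; rewrite /cpl !big_nil; lra.
move=> /andP[/andP[p1 p2] /IHs h]; rewrite !cpl_cons.
have : p.1 * Num.min x p.2 <= p.1 * Num.min y p.2.
  by rewrite ler_wpM2l// le_min !ge_min xy lexx orbT.
lra.
Qed.

Lemma cpl0 al be s : nneg_pairs s -> cpl al be s 0 = al.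
Proof.
elim: s => [|p s IHs] /=; first by rewrite /cpl big_nil mulr0 !addr0.
by move=> /andP[/andP[p1 p2] /IHs h]; rewrite cpl_cons h min_l// mulr0 add0r.
Qed.

Lemma cpl_ge0 al be s x : 0 <= al -> 0 <= be -> nneg_pairs s -> 0 <= x ->
  0 <= cpl al be s x.
Proof.
move=> al0 be0 s0 x0; have := cpl_incr al be s0 x0; rewrite cpl0//.
have : 0 <= be * (x - 0) by rewrite mulr_ge0// subr0.
lra.
Qed.

Lemma cpl_le_affine al be s : nneg_pairs s ->
  exists be', forall x, 0 <= x -> cpl al be s x <= al + be' * x.
Proof.
elim: s => [|p s IHs] /=.
  by move=> _; exists be => x _; rewrite /cpl big_nil addr0.
move=> /andP[/andP[p1 p2] /IHs[be' h]]; exists (p.1 + be') => x /h hx.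
have : p.1 * Num.min x p.2 <= p.1 * x by rewrite ler_wpM2l// ge_min lexx.
rewrite cpl_cons; lra.
Qed.

(** The graph is continued beyond sg by a line of slope b. All breakpoints are capped at sg, and the
    slope lost there, [be - b], becomes the weight of a new one at sg. *)
Lemma cpl_cap al be b s sg x : cpl al b ((be - b, sg) :: [seq (p.1, Num.min p.2 sg) | p <- s]) x =
  cpl al be s (Num.min x sg) + b * (x - Num.min x sg).
Proof.
rewrite cpl_cons /cpl /= big_map /=.
under [in RHS]eq_bigr do rewrite minAC -minA.
ring.
Qed.

(* Every slope of [cpl al be s] is at least [be >= b], so the line [a + b x],
   which starts above, crosses it at most once. *)
Lemma cpl_min_line al be s a b : nneg_pairs s -> al <= a -> b <= be ->
  exists be' s', [/\ nneg_pairs s', b <= be' &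
    forall x, 0 <= x -> cpl al be' s' x = Num.min (cpl al be s x) (a + b * x)].
Proof.
move=> s0 ala bbe.
case: (pselect (exists2 y, 0 <= y & a + b * y < cpl al be s y)) => [[y y0 hy]|nh].
  (* The curve minus the line is al - a <= 0 at 0 and positive at y; the two cross at sg. *)
  have [||sg] := @IVT _ (fun x => cpl al be s x - (a + b * x)) 0 y 0 y0.
  - apply: continuous_subspaceT => x.
    apply: cvgB; first exact: continuous_cpl.
    by apply: cvgD; [exact: cvg_cst|apply: cvgM; [exact: cvg_cst|exact: cvg_id]].
  - rewrite cpl0// mulr0 addr0 ge_min le_max; apply/andP; split.
      by apply/orP; left; lra.
    by apply/orP; right; lra.
  rewrite in_itv/= => /andP[sg0 _] hsg.
  exists b, ((be - b, sg) :: [seq (p.1, Num.min p.2 sg) | p <- s]); split => //.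
    rewrite /= subr_ge0 bbe sg0 /=; rewrite /nneg_pairs all_map.
    by apply: sub_all s0 => p /= /andP[-> p2]; rewrite le_min p2.
  move=> x x0; rewrite cpl_cap.
  have [xsg|sgx] := leP x sg.
    have := cpl_incr al be s0 xsg; rewrite subrr mulr0 addr0 => h.
    rewrite min_l//; have : b * (sg - x) <= be * (sg - x) by rewrite ler_wpM2r// subr_ge0.
    lra.
  have := cpl_incr al be s0 (ltW sgx) => h.
  have : b * (x - sg) <= be * (x - sg) by rewrite ler_wpM2r// subr_ge0 ltW.
  by move=> h1; rewrite min_r; lra.
exists be, s; split => // x x0; rewrite min_l// leNgt; apply/negP => h.
by apply: nh; exists x.
Qed.

Variables (h : R -> R) (C : R).
Hypotheses (h_gt0 : forall x, 0 < x -> 0 < h x)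
  (hC : forall x y, 0 < x -> 0 < y -> h x <= C * Num.max 1 (x / y) * h y).

Let hC_le x y : 0 < x -> x <= y -> h x <= C * h y.
Proof.
move=> x0 xy; have y0 := lt_le_trans x0 xy.
by have := hC x0 y0; rewrite max_l ?mulr1// ler_pdivrMr// mul1r.
Qed.

Let hC_ge x y : 0 < y -> y <= x -> h x <= C * h y / y * x.
Proof.
move=> y0 yx; have x0 := lt_le_trans y0 yx.
have := hC x0 y0; rewrite max_r; last by rewrite ler_pdivlMr// mul1r.
by rewrite (_ : _ * h y = C * h y / y * x)//; ring.
Qed.

Let C_ge1 : 1 <= C.
Proof.
have h1 := h_gt0 ltr01.
by have := hC_le ltr01 (lexx 1); rewrite -ler_pdivrMr// divff// gt_eqF.
Qed.

Let C_gt0 : 0 < C.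
Proof. exact: lt_le_trans C_ge1. Qed.

(** The line attached to a grid point t is C h(t) (1 + x/t). It majorizes h because max(1, x/t) <= 1
    + x/t, and on [t, 2t] it is at most C^2 h + 2 C^2 h. The numbers a and b are the level and the
    slope of the last line; the induction carries what is needed to take the minimum with the next
    one. *)
Lemma concave_majorant_aux (s0 : R) (N : nat) : 0 < s0 -> let sN := s0 * 2 ^+ N in
  exists al be s a b, [/\ [/\ nneg_pairs s, 0 <= al, al <= a, 0 <= b & b <= be],
   (forall x, 0 < x -> h x <= cpl al be s x),
   (forall x, s0 <= x -> x <= 2 * sN -> cpl al be s x <= 3 * C ^+ 2 * h x),
   (forall x, sN <= x -> a <= C ^+ 2 * h x) &
   (forall x, sN <= x -> h x <= b * x)].
Proof.
move=> s00.
have line_ge t x : 0 < t -> 0 < x -> t <= x -> C * h t <= C ^+ 2 * h x.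
  by move=> t0 x0 tx; rewrite expr2 -mulrA ler_pM2l// hC_le.
have Ch t : 0 < t -> 0 < C * h t by move=> t0; rewrite mulr_gt0// h_gt0.
have line_slope t x : 0 < t -> t <= x -> x <= 2 * t -> C * h t / t * x <= 2 * C ^+ 2 * h x.
  move=> t0 tx x2t; rewrite mulrAC ler_pdivrMr//.
  have := line_ge t x t0 (lt_le_trans t0 tx) tx; have := Ch t t0.
  move: (C * h t) (h x) => u v; nra.
elim: N => [|N [al [be [s [a [b [[sok al0 ala b0 bbe] maj upper ah hb]]]]]]] /=.
  rewrite expr0 mulr1.
  exists (C * h s0), (C * h s0 / s0), [::], (C * h s0), (C * h s0 / s0).
  have Cs0 := Ch _ s00; have Css0 : 0 < C * h s0 / s0 by rewrite divr_gt0.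
  split => //.
  - by split => //; exact: ltW.
  - move=> x x0; rewrite /cpl big_nil addr0.
    have [xs|/ltW sx] := leP x s0.
      by apply: (le_trans (hC_le x0 xs)); rewrite lerDl mulr_ge0// ltW.
    by apply: (le_trans (hC_ge s00 sx)); rewrite lerDr ltW.
  - move=> x s0x xs0; rewrite /cpl big_nil addr0.
    have := line_ge _ _ s00 (lt_le_trans s00 s0x) s0x.
    have := line_slope _ _ s00 s0x xs0; lra.
  - by move=> x s0x; apply: line_ge => //; exact: lt_le_trans s0x.
  - by move=> x s0x; exact: hC_ge.
move: ah hb upper; have -> : s0 * 2 ^+ N.+1 = 2 * (s0 * 2 ^+ N) by rewrite exprS; ring.
set t := s0 * 2 ^+ N.
have t0 : 0 < t by rewrite mulr_gt0// exprn_gt0.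
set t' := 2 * t => ah hb upper.
have t'0 : 0 < t' by rewrite mulr_gt0.
have tt' : t <= t' by rewrite /t'; lra.
have Ct' := Ch _ t'0; have Ctt' : 0 < C * h t' / t' by rewrite divr_gt0.
(* C h(t) need not increase with t, nor C h(t)/t decrease. The running maximum and minimum force
   this monotonicity, which [cpl_min_line] requires, and keep the bounds by h. *)
pose a' := Num.max a (C * h t'); pose b' := Num.min b (C * h t' / t').
have b'0 : 0 <= b' by rewrite le_min b0 ltW.
have a'h x : t' <= x -> a' <= C ^+ 2 * h x.
  move=> t'x; rewrite ge_max ah ?(le_trans tt')//=.
  by apply: line_ge => //; exact: lt_le_trans t'x.
have hb' x : t' <= x -> h x <= b' * x.
  move=> t'x; have x0 := lt_le_trans t'0 t'x.
  by rewrite /b' minr_pMl ?(ltW x0)// le_min hb ?(le_trans tt')//= hC_ge.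
have ala' : al <= a' by rewrite le_max ala.
have b'be : b' <= be by rewrite ge_min bbe.
have [be' [s' [s'ok bbe' E]]] := cpl_min_line sok ala' b'be.
exists al, be', s', a', b'; split => //.
(* The new line majorizes h by its constant term below t' and by its linear term above. *)
- move=> x x0; rewrite E ?(ltW x0)// le_min maj//=.
  have [xt|/ltW tx] := leP x t'.
    apply: (le_trans (hC_le x0 xt)); apply: (@le_trans _ _ a').
      by rewrite le_max lexx orbT.
    by rewrite lerDl mulr_ge0// ltW.
  apply: (le_trans (hb' _ tx)); rewrite lerDr.
  by rewrite (le_trans (ltW Ct'))// le_max lexx orbT.
- move=> x s0x xt; have x0 := lt_le_trans s00 s0x.
  rewrite E ?(ltW x0)// ge_min.
  have [xt'|/ltW tx] := leP x t'; first by rewrite upper.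
  apply/orP; right.
  have := a'h _ tx; have := line_slope _ _ t'0 tx xt.
  have : b' * x <= C * h t' / t' * x by rewrite ler_wpM2r ?(ltW x0)// ge_min lexx orbT.
  lra.
Qed.

Lemma concave_majorant (s0 L : R) : 0 < s0 ->
  exists al be s, [/\ nneg_pairs s, 0 <= al, 0 <= be,
   (forall x, 0 < x -> h x <= cpl al be s x) &
   (forall x, s0 <= x -> x <= L -> cpl al be s x <= 3 * C ^+ 2 * h x)].
Proof.
move=> s00.
have [N hN] : exists N, L <= s0 * 2 ^+ N.
  exists (Num.truncn (L / s0)).+1.
  rewrite -ler_pdivrMl// mulrC (le_trans (ltW (truncnS_gt _)))//.
  by rewrite -natrX ler_nat ltnW// ltn_expl.
have [al [be [s [a [b [[sok al0 _ b0 bbe] maj upper _ _]]]]]] := concave_majorant_aux N s00.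
exists al, be, s; split => //; first exact: le_trans bbe.
move=> x s0x xL; apply: upper => //; apply: (le_trans (le_trans xL hN)).
have : 0 <= s0 * 2 ^+ N by rewrite mulr_ge0 ?exprn_ge0// ltW.
lra.
Qed.

End concave_majorant.

(** * The spaces of the scale *)

Section measurable_quotient.
Context {R : realType}.
Implicit Types (D : set (measurableTypeR R)) (f g : measurableTypeR R -> R).

Lemma measurable_fun_comp_pos D f (psi : R -> R) : measurable D ->
  measurable_fun (`]0, +oo[ : set R) psi -> measurable_fun D f ->
  (forall t, D t -> 0 < f t) -> measurable_fun D (fun t => psi (f t)).
Proof.
move=> mD mpsi mf f0.
apply: (@measurable_comp _ _ _ _ _ _ (`]0, +oo[ : set R) psi D f) => //.
by move=> _ [t Dt <-]; rewrite /= in_itv/= f0.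
Qed.

Lemma measurable_fun_div D f g : measurable D ->
  measurable_fun D f -> measurable_fun D g -> (forall t, D t -> 0 < g t) ->
  measurable_fun D (fun t => f t / g t).
Proof.
move=> mD mf mg g0; apply: measurable_funM => //.
apply: (measurable_fun_comp_pos (psi := GRing.inv)) => //.
apply: open_continuous_measurable_fun; first exact: interval_open.
by move=> x; rewrite inE/= in_itv/= andbT => x0; apply: inv_continuous; rewrite gt_eqF.
Qed.

End measurable_quotient.

Section phi_space_theory.
Context {R : realType} {H : hilbertType R} (E : proj_measure H).
Variables (phi : R -> R) (X : phi_space E phi).
Hypothesis phiP : borel_positive phi.
Implicit Types u v : H.

Local Notation D := ([set` `[(1 : R), +oo[] : set (measurableTypeR R)).

Let mD : measurable D. Proof. exact: measurable_itv. Qed.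

Let phi_gt0 t : D t -> 0 < phi t.
Proof. by rewrite /= in_itv/= andbT; exact: phiP.2. Qed.

Let mphi : measurable_fun D (phi : measurableTypeR R -> R).
Proof. exact: phiP.1. Qed.

Lemma sp_inj_hnorm u : dom (sp_op X) u ->
  ((hnorm (sp_inj X u) ^+ 2)%:E = \int[spectral_measure E u]_(t in D) (phi t ^+ 2)%:E)%E.
Proof.
move=> Xu; rewrite /hnorm sp_inj_norm//.
exact: (spectral_integral_hnorm mD mphi phi_gt0 (sp_opP X)).
Qed.

Lemma sp_domE u : dom (sp_op X) u <->
  (\int[spectral_measure E u]_(t in D) (phi t ^+ 2)%:E < +oo)%E.
Proof. exact: (spectral_integral_domE (sp_opP X)). Qed.

Lemma sp_injB u v : dom (sp_op X) u -> dom (sp_op X) v ->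
  sp_inj X (u - v) = sp_inj X u - sp_inj X v.
Proof.
move=> Xu Xv.
have /(_ u v Xu Xv) h := @sp_inj_linear _ _ _ _ X (-1).
rewrite -scaleN1r addrC sp_inj_linear//.
by rewrite addrC scaleN1r.
Qed.

Lemma sp_approx (x : X) (d : R) : 0 < d ->
  exists2 u, dom (sp_op X) u & hnorm (sp_inj X u - x) < d.
Proof.
by move=> d0; have [_ [u Xu <-] ux] := dense_hnorm (@sp_inj_dense _ _ _ _ X) x d0; exists u.
Qed.

Lemma sp_dom_proj (B : set (measurableTypeR R)) u : measurable B ->
  dom (sp_op X) u -> dom (sp_op X) (E B u).
Proof.
by move=> mB Xu; apply: (spectral_integral_dom_proj mD mphi (sp_opP X)).
Qed.

Lemma sp_dom_bounded (B : set (measurableTypeR R)) (M : R) u : measurable B ->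
  (forall t, D t -> B t -> phi t <= M) -> dom (sp_op X) (E B u).
Proof.
move=> mB phiM.
exact: (spectral_integral_dom_bounded mD mphi phi_gt0 (sp_opP X) _ mB phiM).
Qed.

(** Since [sp_op X] commutes with the projections, this is their strong convergence in H at the
    vector [sp_op X u]. *)
Lemma sp_inj_proj_cvg (W : nat -> set (measurableTypeR R)) u :
  (forall n, measurable (W n)) -> nondecreasing_seq W -> \bigcup_n W n = setT ->
  dom (sp_op X) u -> forall d : R, 0 < d ->
  exists n, hnorm (sp_inj X (E (W n) u) - sp_inj X u) < d.
Proof.
move=> mW ndW UW Xu d d0.
have [n hn] := @pm_proj_cvg _ _ E W (sp_op X u) mW ndW UW d d0.
exists n; rewrite hdistC -sp_injB//; last exact: sp_dom_proj.
have XWu := sp_dom_proj (mW n) Xu.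
rewrite /hnorm sp_inj_norm; last exact: linop_domB.
rewrite linop_actB// -(spectral_integral_comm mD mphi phi_gt0 (sp_opP X))//.
Qed.

End phi_space_theory.

(** * Lifting limits through an embedding *)

Section lifting.
Context {R : realType} {Y : completeNormedModType R[i]} {Z : normedModType R[i]}.

Lemma harmonic_small (a e : R) : 0 < e ->
  exists N, forall n, (N <= n)%N -> a * n.+1%:R^-1 < e.
Proof.
move=> e0; exists (Num.truncn (`|a| / e)) => n Nn.
apply: (@le_lt_trans _ _ (`|a| * n.+1%:R^-1)); first by rewrite ler_wpM2r// ler_norm.
rewrite ltr_pdivrMr// mulrC -ltr_pdivrMr// (lt_le_trans (truncnS_gt _))//.
by rewrite ler_nat.
Qed.

Lemma le_add_small (x y b : R) : 0 <= b -> (forall e, 0 < e -> x <= y + b * e) -> x <= y.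
Proof.
move=> b0 xy; apply/ler_addgt0Pr => e e0.
have b1 : 0 < b + 1 by rewrite ltr_wpDl.
apply: (le_trans (xy (e / (b + 1)) (divr_gt0 e0 b1))).
rewrite lerD2l mulrCA ler_piMr ?(ltW e0)// ler_pdivrMr//; lra.
Qed.

(** Used twice: to lift the image of a truncated vector from approximants in Dom eta1(Q), and then
    to pass from truncated vectors to all of [X]. *)
Lemma lift_limit (f : {linear Y -> Z}) (y_ : nat -> Y) (v : Z) (a r : R) :
  continuous f ->
  (forall n m, hnorm (y_ n - y_ m) <= a * n.+1%:R^-1 + a * m.+1%:R^-1) ->
  (forall n, hnorm (f (y_ n) - v) <= a * n.+1%:R^-1) ->
  (forall n, hnorm (y_ n) <= r + a * n.+1%:R^-1) ->
  exists2 y, f y = v & hnorm y <= r.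
Proof.
move=> /continuous_hnorm_bound[M M0 fM] cauchy_y fyv yr.
have [|y hy] := @hnorm_cauchy_cvg _ _ y_.
  move=> e e0; have [N hN] := @harmonic_small a (e / 2) (divr_gt0 e0 (ltr0Sn _ 1)).
  exists N => m n Nm Nn; apply: le_lt_trans (cauchy_y m n) _.
  by rewrite [ltRHS]splitr ltrD// hN.
have near e : 0 < e -> exists n, hnorm (y_ n - y) < e /\ a * n.+1%:R^-1 < e.
  move=> e0; have [N1 h1] := hy _ e0; have [N2 h2] := @harmonic_small a _ e0.
  exists (maxn N1 N2); split; first by rewrite h1// leq_maxl.
  by rewrite h2// leq_maxr.
exists y.
  apply/eqP; rewrite -subr_eq0; apply/eqP/hnorm0_eq0/eqP.
  rewrite eq_le hnorm_ge0 andbT.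
  apply: (@le_add_small _ _ (M + 1)); first by rewrite addr_ge0// ltW.
  move=> e /near[n [h1 h2]]; rewrite add0r.
  apply: (le_trans (ler_hdistD (f (y_ n)) _ _)).
  have := fyv n; have := fM (y_ n - y); rewrite linearB/= (hdistC (f y)).
  have : M * hnorm (y_ n - y) <= M * e by rewrite ler_wpM2l// ltW.
  move=> h3 h4 h5; rewrite mulrDl mul1r.
  exact: le_trans (lerD h4 h5) (lerD h3 (ltW h2)).
apply: (@le_add_small _ _ 2) => // e /near[n [h1 h2]].
have : hnorm y <= hnorm (y_ n) + hnorm (y_ n - y).
  by rewrite (hdistC _ y) addrC -{1}(subrK (y_ n) y) ler_hnormD.
have := yr n; move: h2; move: (_ / _) => z; lra.
Qed.

End lifting.

(** * Integrals of concave weights and the spectral cut *)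

Section weighted_integrals.
Context {R : realType} {H : hilbertType R} (E : proj_measure H).
Variables (w0 w1 : R -> R) (S0 : phi_space E w0) (S1 : phi_space E w1).
Hypotheses (w0P : borel_positive w0) (w1P : borel_positive w1).
Implicit Types (u v : H) (g : R -> R).

Local Notation D := ([set` `[(1 : R), +oo[] : set (measurableTypeR R)).
Local Notation lam t := ((w1 t / w0 t) ^+ 2).

Let mD : measurable D. Proof. exact: measurable_itv. Qed.

Lemma weight_gt0 (w : R -> R) (t : measurableTypeR R) : borel_positive w -> D t -> 0 < w t.
Proof. by move=> wP; rewrite /= in_itv/= andbT; exact: wP.2. Qed.

Lemma lam_gt0 (t : measurableTypeR R) : D t -> 0 < lam t.
Proof. by move=> Dt; rewrite exprn_gt0// divr_gt0// weight_gt0. Qed.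

Lemma weight_sqrE (t : measurableTypeR R) : D t -> w0 t ^+ 2 * lam t = w1 t ^+ 2.
Proof.
by move=> Dt; rewrite -exprMn mulrC divfK// gt_eqF// weight_gt0.
Qed.

Lemma measurable_lam : measurable_fun D (fun t => lam t : R).
Proof.
apply: measurable_funX; apply: measurable_fun_div => //; [exact: w1P.1|exact: w0P.1|].
by move=> t; exact: weight_gt0.
Qed.

Lemma measurable_weighted (k : R) g : continuous g ->
  measurable_fun D (fun t => (w0 t ^+ 2 * g (k * lam t))%:E).
Proof.
move=> cg; apply/measurable_EFinP; apply: measurable_funM.
  by apply: measurable_funX; exact: w0P.1.
apply: (@measurableT_comp _ _ _ _ _ _ g _ (fun t => k * lam t)).
  exact: continuous_measurable_fun.
by apply: measurable_funM; [exact: measurable_cst|exact: measurable_lam].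
Qed.

Let mw (w : R -> R) : borel_positive w -> measurable_fun D (fun t => (w t ^+ 2)%:E).
Proof.
by move=> wP; apply/measurable_EFinP; apply: measurable_funX; exact: wP.1.
Qed.

Let mmin (k sg : R) : measurable_fun D (fun t => (w0 t ^+ 2 * Num.min (k * lam t) sg)%:E).
Proof.
apply: (measurable_weighted k (g := fun x => Num.min x sg)) => x.
by apply: (@continuous_min _ _ id (cst sg)); [exact: cvg_id|exact: cvg_cst].
Qed.

Let w0min_ge0 (k sg : R) t : 0 <= k -> 0 <= sg -> D t ->
  (0 <= (w0 t ^+ 2 * Num.min (k * lam t) sg)%:E)%E.
Proof.
move=> k0 sg0 Dt; rewrite lee_fin mulr_ge0 ?sqr_ge0// le_min sg0 andbT.
by rewrite mulr_ge0// ltW// lam_gt0.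
Qed.

Lemma integral_affine (al be k : R) u : 0 <= al -> 0 <= be -> 0 <= k ->
  dom (sp_op S0) u -> dom (sp_op S1) u ->
  (\int[spectral_measure E u]_(t in D) (w0 t ^+ 2 * (al + be * (k * lam t)))%:E =
   (al * hnorm (sp_inj S0 u) ^+ 2 + be * (k * hnorm (sp_inj S1 u) ^+ 2))%:E)%E.
Proof.
move=> al0 be0 k0 u0 u1.
rewrite EFinD mulrA (EFinM al) (EFinM (be * k)) !sp_inj_hnorm//.
rewrite -!ge0_integralZl_EFin ?mulr_ge0//; last 4 first.
  - by move=> t _; rewrite lee_fin sqr_ge0.
  - exact: mw.
  - by move=> t _; rewrite lee_fin sqr_ge0.
  - exact: mw.
rewrite -ge0_integralD//; last 4 first.
  - by move=> t _; rewrite -EFinM lee_fin mulr_ge0// sqr_ge0.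
  - by apply: measurable_funeM; exact: mw.
  - by move=> t _; rewrite -EFinM lee_fin mulr_ge0 ?sqr_ge0// mulr_ge0.
  - by apply: measurable_funeM; exact: mw.
apply: eq_integral => t; rewrite inE => Dt.
by rewrite -!EFinM -EFinD -(weight_sqrE Dt); congr EFin; ring.
Qed.

(** Holds for every decomposition of b: after the parallelogram law, the minimum is bounded by sg on
    b - b' and by lam on b'. The factor [1 *] matches the shape with k used on the side of A. *)
Lemma integral_min_le (sg : R) b b' : 0 <= sg ->
  dom (sp_op S0) b -> dom (sp_op S0) b' -> dom (sp_op S1) b' ->
  (\int[spectral_measure E b]_(t in D) (w0 t ^+ 2 * Num.min (1 * lam t) sg)%:E <=
   (2 * (sg * hnorm (sp_inj S0 (b - b')%R) ^+ 2 + hnorm (sp_inj S1 b') ^+ 2))%:E)%E.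
Proof.
move=> sg0 b0 b'0 b'1.
have bb'0 := linop_domB b0 b'0.
rewrite -{1}(subrK b' b).
apply: (le_trans (integral_spectral_measureD_le E (b - b') b' mD (mmin 1 sg) _)).
  by move=> t; exact: w0min_ge0.
rewrite (EFinM 2) lee_wpmul2l// EFinD (EFinM sg) !sp_inj_hnorm// -ge0_integralZl_EFin//; last 2 first.
  - by move=> t _; rewrite lee_fin sqr_ge0.
  - exact: mw.
apply: leeD; apply: ge0_le_integral => //.
- by move=> t; exact: w0min_ge0.
- by apply: measurable_funeM; exact: mw.
- move=> t Dt; rewrite -EFinM lee_fin mulrC ler_wpM2r ?sqr_ge0//.
  by rewrite ge_min lexx orbT.
- by move=> t; exact: w0min_ge0.
- exact: mw.
- move=> t Dt; rewrite lee_fin -(weight_sqrE Dt) ler_wpM2l ?sqr_ge0//.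
  by rewrite mul1r ge_min lexx.
Qed.

(** The spectral cut attains equality: within D, the spectral measure of U lives where k lam <= sg
    and that of u - U where k lam > sg, so the minimum is known on each. *)
Lemma integral_min_cut (k sg : R) u : 0 <= k -> 0 <= sg ->
  dom (sp_op S0) u -> dom (sp_op S1) u ->
  exists U, [/\ dom (sp_op S0) U, dom (sp_op S1) U &
  (\int[spectral_measure E u]_(t in D) (w0 t ^+ 2 * Num.min (k * lam t) sg)%:E =
   (sg * hnorm (sp_inj S0 (u - U)%R) ^+ 2 + k * hnorm (sp_inj S1 U) ^+ 2)%:E)%E].
Proof.
move=> k0 sg0 u0 u1.
pose W : set (measurableTypeR R) := D `&` [set t | k * lam t <= sg].
have mW : measurable W.
  apply: measurable_le_set => //.
  by apply: measurable_funM; [exact: measurable_cst|exact: measurable_lam].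
have mDW : measurable (D `\` W) by exact: measurableD.
have mDIW : measurable (D `&` W) by exact: measurableI.
have U0 := sp_dom_proj w0P mW u0; have U1 := sp_dom_proj w1P mW u1.
exists (E W u); split => //.
have sq0 (w : R -> R) t : D t -> (0 <= (w t ^+ 2)%:E)%E by rewrite lee_fin sqr_ge0.
rewrite EFinD (EFinM sg) (EFinM k) !sp_inj_hnorm//; last exact: linop_domB.
rewrite integral_spectral_measure_projC//; [|exact: mw|by move=> t; exact: sq0].
rewrite integral_spectral_measure_proj//; [|exact: mw|by move=> t; exact: sq0].
have mwS (w : R -> R) (C : set (measurableTypeR R)) : borel_positive w -> measurable C -> C `<=` D ->
    measurable_fun C (fun t => (w t ^+ 2)%:E).
  by move=> wP mC CD; exact: measurable_funS (mw wP).
rewrite -{1}(setUIDK D W) ge0_integral_setU//; last 3 first.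
- by rewrite setUIDK; exact: mmin.
- by rewrite setUIDK => t; exact: w0min_ge0.
- by apply/disj_setPS => t [[_ Wt] [_ nWt]].
rewrite addeC -!ge0_integralZl_EFin//; last 4 first.
- by move=> t [Dt _]; exact: sq0.
- by apply: mwS => // t [].
- by move=> t [Dt _]; exact: sq0.
- by apply: mwS => // t [].
congr (_ + _)%E; apply: eq_integral => t; rewrite inE => -[Dt Wt].
  rewrite -EFinM min_r 1?mulrC// ltW// ltNge; apply/negP => h.
  by apply: Wt; split => //=; rewrite mulrC.
rewrite min_l; last by case: Wt.
by rewrite -EFinM -(weight_sqrE Dt); congr EFin; ring.
Qed.

Lemma integral_cpl_cons (al be k m sg : R) (s : seq (R * R)) u :
  0 <= al -> 0 <= be -> 0 <= k -> nneg_pairs ((m, sg) :: s) ->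
  (\int[spectral_measure E u]_(t in D) (w0 t ^+ 2 * cpl al be ((m, sg) :: s) (k * lam t))%:E =
   m%:E * \int[spectral_measure E u]_(t in D) (w0 t ^+ 2 * Num.min (k * lam t) sg)%:E +
   \int[spectral_measure E u]_(t in D) (w0 t ^+ 2 * cpl al be s (k * lam t))%:E)%E.
Proof.
move=> al0 be0 k0 /= /andP[/andP[/= m0 sg0] s0].
rewrite -ge0_integralZl_EFin//; last first.
  by move=> t; exact: w0min_ge0.
rewrite -ge0_integralD//; last 4 first.
- by move=> t Dt; apply: mule_ge0 => //; exact: w0min_ge0.
- by apply: measurable_funeM; exact: mmin.
- move=> t Dt; rewrite lee_fin mulr_ge0 ?sqr_ge0// cpl_ge0// mulr_ge0//.
  by rewrite ltW// lam_gt0.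
- by apply: measurable_weighted; exact: continuous_cpl.
by apply: eq_integral => t _; rewrite cpl_cons/= -EFinM -EFinD; congr EFin; ring.
Qed.

End weighted_integrals.

(** * Quadratic interpolation with a function parameter *)

Section parameter.
Context {R : realType}.
Variables (psi : R -> R) (c : R).
Hypotheses (psiB : classB psi)
  (psi_c : forall t tau : R, 0 < t -> 0 < tau ->
     psi t / psi tau <= c * Num.max 1 (t / tau)).

Let psi_gt0 t : 0 < t -> 0 < psi t. Proof. by case: psiB => _ + _ _; exact. Qed.

Let c_ge1 : 1 <= c.
Proof.
have := psi_c ltr01 ltr01; rewrite divff ?gt_eqF ?psi_gt0//.
by rewrite divr1 maxxx mulr1.
Qed.

(* [psi] acts on [phi1 / phi0], whereas the K-functional involves its square. *)
Definition sqr_parameter (x : R) : R := psi (Num.sqrt x) ^+ 2.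

Lemma sqr_parameter_gt0 x : 0 < x -> 0 < sqr_parameter x.
Proof. by move=> x0; rewrite exprn_gt0// psi_gt0// sqrtr_gt0. Qed.

Lemma sqr_parameter_le x y : 0 < x -> 0 < y ->
  sqr_parameter x <= c ^+ 2 * Num.max 1 (x / y) * sqr_parameter y.
Proof.
move=> x0 y0; have sx0 : 0 < Num.sqrt x by rewrite sqrtr_gt0.
have sy0 : 0 < Num.sqrt y by rewrite sqrtr_gt0.
have := psi_c sx0 sy0; rewrite ler_pdivrMr ?psi_gt0// => h.
have m0 : 0 <= Num.max 1 (Num.sqrt x / Num.sqrt y) by rewrite le_max ler01.
have -> : Num.max 1 (x / y) = Num.max 1 (Num.sqrt x / Num.sqrt y) ^+ 2.
  have -> : x / y = (Num.sqrt x / Num.sqrt y) ^+ 2.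
    by rewrite exprMn exprVn !sqr_sqrtr// ltW.
  have r0 : 0 <= Num.sqrt x / Num.sqrt y by rewrite divr_ge0// sqrtr_ge0.
  have [h1|/ltW h1] := leP 1 (Num.sqrt x / Num.sqrt y).
    by rewrite !max_r// exprn_ege1.
  by rewrite !max_l// ?expr1n// exprn_ile1.
rewrite /sqr_parameter -!exprMn lerXn2r ?nnegrE//; first by rewrite ltW// psi_gt0.
by rewrite !mulr_ge0// ?ltW ?psi_gt0// (lt_le_trans ltr01).
Qed.

(** The supremum is a true one, not the default value 0: the quotients are bounded by c max(1,
    l). *)
Lemma dilation_functionP (l t : R) : 0 < l -> 0 < t ->
  psi (l * t) <= dilation_function psi l * psi t.
Proof.
move=> l0 t0; rewrite -ler_pdivrMr ?psi_gt0//; apply: ub_le_sup; last first.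
  by exists t => //=; rewrite in_itv/= t0.
exists (c * Num.max 1 l) => _ [x + <-]; rewrite /= in_itv/= andbT => x0.
by rewrite (le_trans (psi_c (mulr_gt0 l0 x0) x0))// mulfK// gt_eqF.
Qed.

Lemma dilation_function_ge0 (l : R) : 0 < l -> 0 <= dilation_function psi l.
Proof.
move=> l0; have := dilation_functionP l0 ltr01; rewrite mulr1 => h.
have := psi_gt0 l0; have := psi_gt0 ltr01 => h1 h2.
by rewrite -(pmulr_lge0 _ h1) (le_trans (ltW h2)).
Qed.

Lemma interp_parameterE (w0 w1 : R -> R) t : 0 < w0 t -> 0 < w1 t ->
  interp_parameter w0 w1 psi t ^+ 2 = w0 t ^+ 2 * sqr_parameter ((w1 t / w0 t) ^+ 2).
Proof.
move=> w00 w10; rewrite /interp_parameter /sqr_parameter sqrtr_sqr exprMn.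
by rewrite ger0_norm// divr_ge0// ltW.
Qed.

Lemma interp_parameter_borel (w0 w1 : R -> R) :
  borel_positive w0 -> borel_positive w1 ->
  borel_positive (interp_parameter w0 w1 psi).
Proof.
move=> w0P w1P; split; last first.
  by move=> t t1; rewrite mulr_gt0 ?w0P.2// psi_gt0// divr_gt0 ?w0P.2 ?w1P.2.
have w0D t : (`[1, +oo[ : set R)%classic t -> 0 < w0 t.
  by rewrite /= in_itv/= andbT; exact: w0P.2.
have w1D t : (`[1, +oo[ : set R)%classic t -> 0 < w1 t.
  by rewrite /= in_itv/= andbT; exact: w1P.2.
apply: measurable_funM; first exact: w0P.1.
apply: measurable_fun_comp_pos => //; first by case: psiB.
  by apply: measurable_fun_div => //; [exact: w1P.1|exact: w0P.1].
by move=> t Dt; rewrite divr_gt0 ?w0D ?w1D.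
Qed.

End parameter.

(** * The action of T on integrals of piecewise linear concave weights *)

Section interpolation.
Context {R : realType} {H G : hilbertType R} (EA : proj_measure H) (EQ : proj_measure G).
Variables (phi0 phi1 eta0 eta1 : R -> R).
Hypotheses (phi0P : borel_positive phi0) (phi1P : borel_positive phi1)
  (eta0P : borel_positive eta0) (eta1P : borel_positive eta1).
Variables (X0 : phi_space EA phi0) (X1 : phi_space EA phi1)
  (Y0 : phi_space EQ eta0) (Y1 : phi_space EQ eta1)
  (e1 : {linear X1 -> X0}) (f1 : {linear Y1 -> Y0})
  (T : {linear X0 -> Y0}) (T1 : {linear X1 -> Y1}).
Hypotheses (e1P : is_embedding e1) (f1P : is_embedding f1)
  (T_bounded : continuous T) (T1_bounded : continuous T1)
  (T1_restr : is_restriction e1 f1 T T1) (T_gt0 : 0 < opnorm T).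

Local Notation D := ([set` `[(1 : R), +oo[] : set (measurableTypeR R)).
Local Notation lamX t := ((phi1 t / phi0 t) ^+ 2).
Local Notation lamY t := ((eta1 t / eta0 t) ^+ 2).
Local Notation M0 := (opnorm T).
Local Notation M1 := (opnorm T1).

Let domX u : dom (sp_op X1) u -> dom (sp_op X0) u.
Proof. by case: e1P => + _ _ => /[apply] -[]. Qed.

Let domY u : dom (sp_op Y1) u -> dom (sp_op Y0) u.
Proof. by case: f1P => + _ _ => /[apply] -[]. Qed.

Lemma T_sp_inj u : dom (sp_op X1) u -> T (sp_inj X0 u) = f1 (T1 (sp_inj X1 u)).
Proof. by move=> u1; rewrite -T1_restr; case: e1P => /(_ u u1)[_ ->]. Qed.

(** The right side exceeds (a + d)^2 by 3 (a/3 - d)^2. *)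
Let sqr_approx (x a d : R) : 0 <= x -> 0 <= a -> 0 <= d -> x <= a + d ->
  x ^+ 2 <= 4 / 3 * a ^+ 2 + 4 * d ^+ 2.
Proof.
move=> x0 a0 d0 xad.
have : x ^+ 2 <= (a + d) ^+ 2 by rewrite lerXn2r ?nnegrE// addr_ge0.
have := sqr_ge0 (a / 3 - d); nra.
Qed.

Let est1 u b (d : R) : hnorm (sp_inj Y1 b - T1 (sp_inj X1 u)) <= d ->
  hnorm (sp_inj Y1 b) ^+ 2 <= 4 / 3 * (M1 * hnorm (sp_inj X1 u)) ^+ 2 + 4 * d ^+ 2.
Proof.
move=> bd; have d0 := le_trans (hnorm_ge0 _) bd.
apply: sqr_approx => //; rewrite ?mulr_ge0 ?hnorm_ge0 ?opnorm_ge0//.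
have -> : sp_inj Y1 b = T1 (sp_inj X1 u) + (sp_inj Y1 b - T1 (sp_inj X1 u)).
  by rewrite addrC subrK.
by rewrite (le_trans (ler_hnormD _ _))// lerD// opnorm_bound.
Qed.

(** In [Y0] the error is the image under [f1] of the error in [Y1], hence at most C1 d. *)
Let est0 (C1 : R) u b (d : R) : 0 < C1 -> (forall y, hnorm (f1 y) <= C1 * hnorm y) ->
  dom (sp_op X1) u -> dom (sp_op Y1) b ->
  hnorm (sp_inj Y1 b - T1 (sp_inj X1 u)) <= d ->
  hnorm (sp_inj Y0 b) ^+ 2 <= 4 / 3 * (M0 * hnorm (sp_inj X0 u)) ^+ 2 + 4 * (C1 * d) ^+ 2.
Proof.
move=> C10 fC u1 b1 bd; have d0 := le_trans (hnorm_ge0 _) bd.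
apply: sqr_approx => //; rewrite ?mulr_ge0 ?hnorm_ge0 ?opnorm_ge0// ?(ltW C10)//.
have -> : sp_inj Y0 b = T (sp_inj X0 u) + f1 (sp_inj Y1 b - T1 (sp_inj X1 u)).
  rewrite T_sp_inj// linearB/= addrC subrK.
  by case: f1P => /(_ b b1)[_ ->].
rewrite (le_trans (ler_hnormD _ _))// lerD// ?opnorm_bound//.
by rewrite (le_trans (fC _))// ler_pM2l.
Qed.

(** Approximants are chosen for all w at once: every breakpoint has its own cut U and needs an
    approximant of [T1 U], next to the common one of [T1 u]. *)
Definition approximates (d : R) (cc : Y1 -> G) :=
  forall w, dom (sp_op Y1) (cc w) /\ hnorm (sp_inj Y1 (cc w) - w) <= d.

Lemma approximates_exists (d : R) : 0 < d -> exists cc, approximates d cc.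
Proof.
move=> d0.
have /choice[cc hcc] : forall w, exists b,
    dom (sp_op Y1) b /\ hnorm (sp_inj Y1 b - w) <= d.
  by move=> w; have [b b1 /ltW bw] := sp_approx w d0; exists b.
by exists cc.
Qed.

(** K is fixed before d and [cc], so that the error vanishes as d tends to 0 with u and the weight
    held fixed. Induction on the breakpoints reduces the estimate to an affine weight and single
    minima. *)
Lemma cpl_estimate u (al be : R) (s : seq (R * R)) : dom (sp_op X1) u ->
  0 <= al -> 0 <= be -> nneg_pairs s ->
  exists2 K : R, 0 <= K & forall d cc, 0 < d -> approximates d cc ->
  (\int[spectral_measure EQ (cc (T1 (sp_inj X1 u)))]_(t in D)
     (eta0 t ^+ 2 * cpl al be s (1 * lamY t))%:E <=
   (8 / 3 * M0 ^+ 2)%:E * \int[spectral_measure EA u]_(t in D)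
     (phi0 t ^+ 2 * cpl al be s ((M1 / M0) ^+ 2 * lamX t))%:E + (K * d ^+ 2)%:E)%E.
Proof.
move=> u1 al0 be0; have u0 := domX u1.
have [C1 C10 fC] : exists2 C1 : R, 0 < C1 & forall y, hnorm (f1 y) <= C1 * hnorm y.
  by case: f1P => _ /continuous_hnorm_bound.
have MM : M1 ^+ 2 = M0 ^+ 2 * (M1 / M0) ^+ 2.
  by rewrite -exprMn mulrC divfK// gt_eqF.
have M00 : 0 <= M0 ^+ 2 by rewrite sqr_ge0.
have k0 : 0 <= (M1 / M0) ^+ 2 by rewrite sqr_ge0.
set k := (M1 / M0) ^+ 2 in MM k0 *.
elim: s => [_|[m sg] s IHs /= /andP[/andP[/= m0 sg0] /[dup] sok /IHs[K K0 hK]]].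
  exists (4 * (al * C1 ^+ 2 + be)).
    by rewrite mulr_ge0// addr_ge0// mulr_ge0// sqr_ge0.
  move=> d cc d0 /(_ (T1 (sp_inj X1 u))); set b := cc _ => -[b1 bd].
  have b0 := domY b1.
  under eq_integral do rewrite /cpl big_nil addr0.
  under [in leRHS]eq_integral do rewrite /cpl big_nil addr0.
  rewrite (integral_affine eta0P eta1P (S0 := Y0) (S1 := Y1))//.
  rewrite (integral_affine phi0P phi1P (S0 := X0) (S1 := X1))//.
  rewrite mul1r -EFinM -EFinD lee_fin.
  have := est1 bd; have := est0 C10 fC u1 b1 bd.
  rewrite !exprMn MM.
  set m0 := M0 ^+ 2 in M00 *.
  have := sqr_ge0 (hnorm (sp_inj X0 u)); have := sqr_ge0 (hnorm (sp_inj X1 u)).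
  move: (hnorm (sp_inj X0 u) ^+ 2) (hnorm (sp_inj X1 u) ^+ 2) => x0 x1 x10 x00 h0 h1.
  have h0' := ler_wpM2l al0 h0; have h1' := ler_wpM2l be0 h1.
  have p0 : 0 <= al * (m0 * x0) := mulr_ge0 al0 (mulr_ge0 M00 x00).
  have p1 : 0 <= be * (m0 * k * x1) :=
    mulr_ge0 be0 (mulr_ge0 (mulr_ge0 M00 k0) x10).
  by apply: (le_trans (lerD h0' h1')); lra.
(* The cut depends on sg. On the side of Q it is mirrored by b = (b - b') + b', where b'
   approximates the image of U. *)
have [U [U0 U1 EU]] := integral_min_cut (S0 := X0) (S1 := X1) phi0P phi1P k0 sg0 u0 u1.
(* The difference b - b' is off by 2 d, hence 4 (2 C1 d)^2 = 16 C1^2 d^2 in [Y0]; b' contributes 4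
   d^2; the outer 2 is that of the parallelogram law. *)
exists (m * (2 * (16 * (sg * C1 ^+ 2) + 4)) + K).
  by rewrite addr_ge0// mulr_ge0// mulr_ge0// addr_ge0// mulr_ge0// mulr_ge0// sqr_ge0.
move=> d cc d0 ccP.
have [b1 bd] := ccP (T1 (sp_inj X1 u)).
have [b'1 b'd] := ccP (T1 (sp_inj X1 U)).
have := hK _ _ d0 ccP.
set b := cc _ in b1 bd *; set b' := cc _ in b'1 b'd *.
have b0 := domY b1; have b'0 := domY b'1.
have bb'd : hnorm (sp_inj Y1 (b - b') - T1 (sp_inj X1 (u - U))) <= 2 * d.
  rewrite !sp_injB// linearB/=.
  rewrite (_ : _ - _ = sp_inj Y1 b - T1 (sp_inj X1 u) - (sp_inj Y1 b' - T1 (sp_inj X1 U))); last first.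
    by rewrite !opprB addrACA [RHS]addrACA [X in _ + X = _]addrC.
  by rewrite (le_trans (ler_hnormB _ _))// mulr2n mulrDl mul1r lerD.
have h0 := est0 C10 fC (linop_domB u1 U1) (linop_domB b1 b'1) bb'd.
have h1 := est1 b'd.
rewrite !integral_cpl_cons// ?EU//; try by rewrite /= m0 sg0 sok.
have hmin := integral_min_le (S0 := Y0) (S1 := Y1) eta0P eta1P sg0 b0 b'0 b'1.
move=> hs.
(* [Js] stays an extended real, so distributivity is obtained from nonnegativity. *)
set Js := (\int[_]_(t in D) (phi0 t ^+ 2 * cpl al be s _)%:E)%E in hs *.
have Js0 : (0 <= Js)%E.
  apply: integral_ge0 => t Dt; rewrite lee_fin mulr_ge0 ?sqr_ge0// cpl_ge0//.
  by rewrite mulr_ge0// ltW// (lam_gt0 phi0P phi1P).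
have r0 : 0 <= sg * hnorm (sp_inj X0 (u - U)) ^+ 2 + k * hnorm (sp_inj X1 U) ^+ 2.
  by rewrite addr_ge0// mulr_ge0// sqr_ge0.
have mulJs (a x : \bar R) : (0 <= x)%E -> (a * (x + Js) = a * x + a * Js)%E.
  by move=> x0; rewrite ge0_muleDr.
rewrite mulJs; last by rewrite -EFinM lee_fin mulr_ge0.
have {}hmin := lee_wpmul2l (m0 : (0 <= m%:E)%E) hmin.
apply: (le_trans (leeD hmin hs)).
rewrite addeCA -[leRHS]addeA [leRHS]addeCA leeD2l//.
rewrite -!EFinM -!EFinD lee_fin.
move: h0 h1; rewrite !exprMn MM.
have := sqr_ge0 (hnorm (sp_inj X0 (u - U))); have := sqr_ge0 (hnorm (sp_inj X1 U)).
move: (hnorm (sp_inj X0 _) ^+ 2) (hnorm (sp_inj X1 _) ^+ 2) => x0 x1 x10 x00 h0 h1.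
have h0' := ler_wpM2l (mulr_ge0 m0 sg0) h0; have h1' := ler_wpM2l m0 h1.
lra.
Qed.

End interpolation.

(** * Comparison of the intermediate norm with its majorants *)

Section domination.
Context {R : realType} {H : hilbertType R} (E : proj_measure H).
Variables (psi w0 w1 : R -> R) (c : R).
Hypotheses (psiB : classB psi)
  (psi_c : forall t tau : R, 0 < t -> 0 < tau ->
     psi t / psi tau <= c * Num.max 1 (t / tau))
  (w0P : borel_positive w0) (w1P : borel_positive w1).

Local Notation D := ([set` `[(1 : R), +oo[] : set (measurableTypeR R)).
Local Notation w := (interp_parameter w0 w1 psi).
Local Notation lam t := ((w1 t / w0 t) ^+ 2).

Let mD : measurable D. Proof. exact: measurable_itv. Qed.

Let wP : borel_positive w. Proof. exact: interp_parameter_borel. Qed.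

Let mw2 : measurable_fun D (fun t => (w t ^+ 2)%:E).
Proof. by apply/measurable_EFinP; apply: measurable_funX; exact: wP.1. Qed.

Lemma integral_interp_le_cpl (al be : R) (s : seq (R * R)) b :
  (forall x, 0 < x -> sqr_parameter psi x <= cpl al be s x) ->
  (\int[spectral_measure E b]_(t in D) (w t ^+ 2)%:E <=
   \int[spectral_measure E b]_(t in D) (w0 t ^+ 2 * cpl al be s (1 * lam t))%:E)%E.
Proof.
move=> hcpl; apply: ge0_le_integral => //.
- by move=> t Dt; rewrite lee_fin sqr_ge0.
- by apply: (measurable_weighted w0P w1P); exact: continuous_cpl.
- move=> t Dt; rewrite lee_fin interp_parameterE ?(weight_gt0 w0P Dt) ?(weight_gt0 w1P Dt)//.
  by rewrite mul1r ler_wpM2l ?sqr_ge0// hcpl// (lam_gt0 w0P w1P).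
Qed.

(** The spectral measure of u lives on B, where l^2 lam stays in the interval on which g is
    controlled; there g(l^2 lam) is at most 3 c^4 psi(l w1/w0)^2, and the dilation function extracts
    l. *)
Lemma integral_cpl_le_interp (al be : R) (s : seq (R * R)) (nu2 L l : R) u
  (B : set (measurableTypeR R)) : 0 < l -> measurable B -> E B u = u ->
  (forall x, l ^+ 2 * nu2 <= x -> x <= l ^+ 2 * L ->
     cpl al be s x <= 3 * (c ^+ 2) ^+ 2 * sqr_parameter psi x) ->
  0 <= al -> 0 <= be -> nneg_pairs s ->
  (forall t, D t -> B t -> nu2 <= lam t <= L) ->
  (\int[spectral_measure E u]_(t in D) (w0 t ^+ 2 * cpl al be s (l ^+ 2 * lam t))%:E <=
   (3 * (c ^+ 2) ^+ 2 * dilation_function psi l ^+ 2)%:E *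
   \int[spectral_measure E u]_(t in D) (w t ^+ 2)%:E)%E.
Proof.
move=> l0 mB Bu hcpl al0 be0 s0 lamB.
have d0 := dilation_function_ge0 psiB psi_c l0.
have mg : measurable_fun D (fun t => (w0 t ^+ 2 * cpl al be s (l ^+ 2 * lam t))%:E).
  by apply: (measurable_weighted w0P w1P); exact: continuous_cpl.
have g0 t : D t -> (0 <= (w0 t ^+ 2 * cpl al be s (l ^+ 2 * lam t))%:E)%E.
  move=> Dt; rewrite lee_fin mulr_ge0 ?sqr_ge0// cpl_ge0//.
  exact: mulr_ge0 (sqr_ge0 _) (sqr_ge0 _).
have C0 : 0 <= 3 * (c ^+ 2) ^+ 2 * dilation_function psi l ^+ 2.
  exact: mulr_ge0 (mulr_ge0 _ (sqr_ge0 _)) (sqr_ge0 _).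
have mDB : measurable (D `&` B) by exact: measurableI.
rewrite -{1 2}Bu !integral_spectral_measure_proj//; last first.
  by move=> t _; rewrite lee_fin sqr_ge0.
rewrite -ge0_integralZl_EFin//; last 2 first.
- by move=> t _; rewrite lee_fin sqr_ge0.
- exact: measurable_funS mw2.
apply: ge0_le_integral => //.
- by move=> t [/g0].
- exact: measurable_funS mg.
- by apply: measurable_funeM; exact: measurable_funS mw2.
move=> t [Dt Bt]; have /andP[nut tL] := lamB _ Dt Bt.
have w00 := weight_gt0 w0P Dt; have w10 := weight_gt0 w1P Dt.
rewrite -EFinM lee_fin interp_parameterE// [leRHS]mulrCA ler_wpM2l ?sqr_ge0//.
have l20 : 0 < l ^+ 2 by rewrite exprn_gt0.
apply: (le_trans (hcpl _ _ _)); rewrite ?ler_pM2l//.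
rewrite -[leRHS]mulrA ler_wpM2l ?(mulr_ge0 _ (sqr_ge0 _))//.
have r0 : 0 < w1 t / w0 t by rewrite divr_gt0.
rewrite /sqr_parameter -!exprMn !sqrtr_sqr.
rewrite (gtr0_norm r0) (gtr0_norm (mulr_gt0 l0 r0)).
have psi0 x : 0 < x -> 0 < psi x by case: psiB => _ + _ _; exact.
rewrite lerXn2r ?nnegrE//.
- by rewrite ltW// psi0// mulr_gt0.
- by rewrite mulr_ge0// ltW// psi0.
exact: (dilation_functionP psiB psi_c).
Qed.

(** Supplies the left end of the interval on which the majorant is controlled. *)
Lemma bounded_lam_ge : [bounded w0 t / w1 t | t in `[1, +oo[] ->
  exists2 nu2 : R, 0 < nu2 & forall t : measurableTypeR R, D t -> nu2 <= lam t.
Proof.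
move=> /pinfty_ex_gt0[M M0 hM].
exists (M ^- 2); first by rewrite invr_gt0 exprn_gt0.
move=> t Dt; have w00 := weight_gt0 w0P Dt; have w10 := weight_gt0 w1P Dt.
have : `|w0 t / w1 t| <= M by apply: hM.
have q0 : 0 < w0 t / w1 t by rewrite divr_gt0.
rewrite gtr0_norm// => h.
have -> : lam t = (w0 t / w1 t) ^- 2 by rewrite -exprVn invf_div.
by rewrite lef_pV2 ?posrE ?exprn_gt0// lerXn2r ?nnegrE// ltW.
Qed.

Variables (S0 : phi_space E w0) (S1 : phi_space E w1) (S : phi_space E w).

(** Puts the approximants taken from Dom w1 into the domain of the intermediate operator and
    transfers Cauchy estimates from [S1] to [S]. A concave majorant grows at most linearly, and [f1]
    bounds the norm of index 0 by that of index 1. *)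
Lemma sp_interp_bound (f1 : {linear S1 -> S0}) : is_embedding f1 ->
  exists2 K : R, 0 <= K & forall b, dom (sp_op S1) b ->
    dom (sp_op S) b /\ hnorm (sp_inj S b) <= K * hnorm (sp_inj S1 b).
Proof.
move=> [f1E /continuous_hnorm_bound[C C0 fC] _].
(* Only the majorization is used, so the interval from 1 to 1 is an arbitrary choice. *)
have [al [be [s [sok al0 be0 maj _]]]] := concave_majorant
  (fun x => @sqr_parameter_gt0 _ _ psiB x) (sqr_parameter_le psiB psi_c) 1 ltr01.
have [be' hbe] := cpl_le_affine al be sok.
have be'0 : 0 <= `|be'| by [].
pose K := Num.sqrt (al * C ^+ 2 + `|be'|).
have K0 : 0 <= al * C ^+ 2 + `|be'| by rewrite addr_ge0// mulr_ge0// sqr_ge0.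
exists K; first exact: sqrtr_ge0.
move=> b b1; have [b0 fb] := f1E _ b1.
have bC : hnorm (sp_inj S0 b) <= C * hnorm (sp_inj S1 b) by rewrite -fb fC.
have le_b : (\int[spectral_measure E b]_(t in D) (w t ^+ 2)%:E <=
    ((K * hnorm (sp_inj S1 b)) ^+ 2)%:E)%E.
  apply: (le_trans (integral_interp_le_cpl b maj)).
  apply: (@le_trans _ _ (\int[spectral_measure E b]_(t in D)
    (w0 t ^+ 2 * (al + `|be'| * (1 * lam t)))%:E)%E).
    apply: ge0_le_integral => //.
    - move=> t Dt; rewrite lee_fin mulr_ge0 ?sqr_ge0// cpl_ge0//.
      by rewrite mul1r ltW// (lam_gt0 w0P w1P).
    - by apply: (measurable_weighted w0P w1P); exact: continuous_cpl.
    - apply: (measurable_weighted w0P w1P 1 (g := fun x => al + `|be'| * x)) => x.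
      by apply: cvgD; [exact: cvg_cst|apply: cvgM; [exact: cvg_cst|exact: cvg_id]].
    - move=> t Dt; have lt0 := lam_gt0 w0P w1P Dt.
      rewrite lee_fin ler_wpM2l ?sqr_ge0// (le_trans (hbe _ _)) ?mul1r ?(ltW lt0)//.
      by rewrite lerD2l ler_wpM2r ?(ltW lt0)// ler_norm.
  rewrite (integral_affine w0P w1P (S0 := S0) (S1 := S1))// lee_fin mul1r.
  rewrite exprMn sqr_sqrtr// mulrDl lerD2r// -mulrA ler_wpM2l// -exprMn.
  by rewrite lerXn2r ?nnegrE ?mulr_ge0 ?hnorm_ge0 ?(ltW C0).
have Sb : dom (sp_op S) b.
  by apply/sp_domE; apply: le_lt_trans le_b _; rewrite ltry.
split => //; move: le_b; rewrite -(sp_inj_hnorm (X := S) wP)// lee_fin.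
by rewrite ler_pXn2r ?nnegrE ?mulr_ge0 ?hnorm_ge0 ?sqrtr_ge0.
Qed.

End domination.

(** * The interpolated operator on truncated vectors and on the whole space *)

Section interpolated_operator.
Context {R : realType} {H G : hilbertType R} (EA : proj_measure H) (EQ : proj_measure G).
Variables (phi0 phi1 eta0 eta1 psi : R -> R) (c : R).
Hypotheses (phi0P : borel_positive phi0) (phi1P : borel_positive phi1)
  (eta0P : borel_positive eta0) (eta1P : borel_positive eta1)
  (phi01_bounded : [bounded phi0 t / phi1 t | t in `[1, +oo[])
  (psiB : classB psi)
  (psi_c : forall t tau : R, 0 < t -> 0 < tau ->
     psi t / psi tau <= c * Num.max 1 (t / tau)).
Variables (X0 : phi_space EA phi0) (X1 : phi_space EA phi1)
  (X : phi_space EA (interp_parameter phi0 phi1 psi))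
  (Y0 : phi_space EQ eta0) (Y1 : phi_space EQ eta1)
  (Y : phi_space EQ (interp_parameter eta0 eta1 psi))
  (e1 : {linear X1 -> X0}) (e : {linear X -> X0})
  (f1 : {linear Y1 -> Y0}) (f : {linear Y -> Y0})
  (T : {linear X0 -> Y0}) (T1 : {linear X1 -> Y1}).
Hypotheses (e1P : is_embedding e1) (eP : is_embedding e)
  (f1P : is_embedding f1) (fP : is_embedding f)
  (T_neq0 : exists u, T u != 0) (T_bounded : continuous T)
  (T1_restr : is_restriction e1 f1 T T1) (T1_bounded : continuous T1).

Local Notation D := ([set` `[(1 : R), +oo[] : set (measurableTypeR R)).
Local Notation M0 := (opnorm T).
Local Notation M1 := (opnorm T1).
Local Notation bound := (c ^+ 2 * Num.sqrt 8 * M0 * dilation_function psi (M1 / M0)).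

Let mD : measurable D. Proof. exact: measurable_itv. Qed.

Let phiP : borel_positive (interp_parameter phi0 phi1 psi).
Proof. exact: interp_parameter_borel. Qed.

Let etaP : borel_positive (interp_parameter eta0 eta1 psi).
Proof. exact: interp_parameter_borel. Qed.

(** The bound on phi1 puts projected vectors into Dom phi1(A); the bound on phi1/phi0 supplies the
    right end of the interval for the majorant. Complements are used so that these sets exhaust the
    whole line, as [pm_proj_cvg] demands. *)
Definition truncation (n : nat) : set (measurableTypeR R) :=
  ~` (D `&` [set t | n%:R < phi1 t]) `&` ~` (D `&` [set t | n%:R < phi1 t / phi0 t]).

Let mlt (n : nat) (g : R -> R) : measurable_fun D (g : measurableTypeR R -> R) ->
  measurable (~` (D `&` [set t | n%:R < g t])).
Proof.
by move=> mg; apply: measurableC; apply: measurable_lt_set => //; exact: measurable_cst.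
Qed.

Let mtruncation n : measurable (truncation n).
Proof.
apply: measurableI; apply: mlt; first exact: phi1P.1.
apply: measurable_fun_div => //; [exact: phi1P.1|exact: phi0P.1|].
by move=> t; exact: weight_gt0.
Qed.

Let truncation_le n t : D t -> truncation n t -> phi1 t <= n%:R /\ phi1 t / phi0 t <= n%:R.
Proof.
move=> Dt [/not_andP h1 /not_andP h2]; split; rewrite leNgt; apply/negP => h.
  by case: h1.
by case: h2.
Qed.

Let truncation_nd : nondecreasing_seq truncation.
Proof.
move=> m n mn; apply/subsetPset => t [h1 h2].
have mn' : m%:R <= n%:R :> R by rewrite ler_nat.
by split=> -[Dt /= h]; [apply: h1|apply: h2]; split => //=; exact: le_lt_trans h.
Qed.

Let truncationT : \bigcup_n truncation n = setT.
Proof.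
apply/seteqP; split => // t _.
exists (maxn (Num.truncn (phi1 t)).+1 (Num.truncn (phi1 t / phi0 t)).+1) => //.
have lemax (x : R) m : ((Num.truncn x).+1 <= m)%N -> ~ (m%:R < x).
  move=> xm h; have := lt_trans h (truncnS_gt x).
  by rewrite ltr_nat ltnNge xm.
by split=> -[_ /=]; apply: lemax; [exact: leq_maxl|exact: leq_maxr].
Qed.

Lemma dom_truncation u n : dom (sp_op X1) (EA (truncation n) u).
Proof.
apply: (@sp_dom_bounded _ _ _ _ X1 phi1P _ n%:R) => // t Dt /(truncation_le Dt).
by case.
Qed.

Lemma opnorm_gt0 : 0 < M0.
Proof.
rewrite lt_def opnorm_ge0 andbT; apply/eqP => M00.
have [u] := T_neq0; rewrite (_ : T u = 0) ?eqxx//; apply: hnorm0_eq0.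
apply/eqP; rewrite eq_le hnorm_ge0 andbT.
by rewrite (le_trans (opnorm_bound T_bounded u))// M00 mul0r.
Qed.

(* [Dom phi1(A)] is dense in [X0], so [T] cannot vanish on [X1]. *)
Lemma opnorm1_gt0 : 0 < M1.
Proof.
rewrite lt_def opnorm_ge0 andbT; apply/eqP => M10.
have T1_0 w : T1 w = 0.
  apply: hnorm0_eq0; apply/eqP; rewrite eq_le hnorm_ge0 andbT.
  by rewrite (le_trans (opnorm_bound T1_bounded w))// M10 mul0r.
have [x] := T_neq0; apply/negP; rewrite negbK; apply/eqP/hnorm0_eq0/eqP.
rewrite eq_le hnorm_ge0 andbT.
apply: (@le_add_small _ _ _ (M0 * 2)); first by rewrite mulr_ge0// opnorm_ge0.
move=> d d0; rewrite add0r.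
have [u u0 ux] := sp_approx x d0.
have [n un] := sp_inj_proj_cvg phi0P mtruncation truncation_nd truncationT u0 d0.
have -> : T x = T (x - sp_inj X0 (EA (truncation n) u)).
  rewrite linearB/= (T_sp_inj e1P T1_restr (dom_truncation u n)).
  by rewrite T1_0 linear0 subr0.
rewrite (le_trans (opnorm_bound T_bounded _))// -mulrA ler_wpM2l ?opnorm_ge0//.
rewrite hdistC (le_trans (ler_hdistD (sp_inj X0 u) _ _))//.
rewrite mulr2n mulrDl mul1r; apply: lerD; exact: ltW.
Qed.

(** With lam confined to an interval on B, one majorant and one constant K serve all the
    approximants of [T1 u]; the limit is then taken in [Y]. *)
Lemma interp_bound u (B : set (measurableTypeR R)) (L : R) :
  dom (sp_op X1) u -> dom (sp_op X) u -> measurable B -> EA B u = u ->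
  (forall t, D t -> B t -> phi1 t / phi0 t <= L) ->
  exists2 y, f y = T (e (sp_inj X u)) & hnorm y <= bound * hnorm (sp_inj X u).
Proof.
move=> u1 uX mB Bu hL.
have M0gt0 := opnorm_gt0; have M1gt0 := opnorm1_gt0.
have l0 : 0 < M1 / M0 by rewrite divr_gt0.
have dil0 := dilation_function_ge0 psiB psi_c l0.
have bound0 : 0 <= bound.
  exact: mulr_ge0 (mulr_ge0 (mulr_ge0 (sqr_ge0 _) (sqrtr_ge0 _)) (ltW M0gt0)) dil0.
have [nu2 nu20 hnu2] := bounded_lam_ge phi0P phi1P phi01_bounded.
have [al [be [s [sok al0 be0 maj upper]]]] := concave_majorant
  (fun x => @sqr_parameter_gt0 _ _ psiB x) (sqr_parameter_le psiB psi_c)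
  ((M1 / M0) ^+ 2 * L ^+ 2) (mulr_gt0 (exprn_gt0 2 l0) nu20).
have lamB (t : measurableTypeR R) : D t -> B t -> nu2 <= (phi1 t / phi0 t) ^+ 2 <= L ^+ 2.
  move=> Dt Bt; rewrite hnu2//=.
  have r0 : 0 < phi1 t / phi0 t by rewrite divr_gt0// weight_gt0.
  by rewrite lerXn2r ?nnegrE ?(ltW r0) ?hL// (le_trans (ltW r0))// hL.
have [K K0 hK] := cpl_estimate phi0P phi1P eta0P eta1P e1P f1P T_bounded T1_bounded
  T1_restr M0gt0 u1 al0 be0 sok.
have [K' K'0 hK'] := sp_interp_bound psiB psi_c eta0P eta1P Y f1P.
have [C1 C10 fC] : exists2 C1 : R, 0 < C1 & forall y, hnorm (f1 y) <= C1 * hnorm y.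
  by case: f1P => _ /continuous_hnorm_bound.
have /choice[cc ccP] : forall n : nat, exists cc, @approximates _ _ EQ eta1 Y1 n.+1%:R^-1 cc.
  by move=> n; apply: approximates_exists; rewrite invr_gt0.
pose w := T1 (sp_inj X1 u); pose b n := cc n w.
have b1 n : dom (sp_op Y1) (b n) by case: (ccP n w).
have bw n : hnorm (sp_inj Y1 (b n) - w) <= n.+1%:R^-1 by case: (ccP n w).
have bY n : dom (sp_op Y) (b n) by case: (hK' _ (b1 n)).
have eu : T (e (sp_inj X u)) = f1 w.
  by case: eP => /(_ _ uX)[_ ->] _ _; exact: (T_sp_inj e1P T1_restr u1).
(* One rate for three purposes: sqrt K for the excess in norm, K' for the Cauchy property in [Y], C1
   for convergence in [Y0]. *)
pose a := Num.sqrt K + K' + C1.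
have K2 : 0 <= Num.sqrt K := sqrtr_ge0 K.
apply: (lift_limit (y_ := fun n => sp_inj Y (b n)) (a := a)).
- by case: fP.
- move=> n m; rewrite -sp_injB// -mulrDr.
  have [_ /le_trans] := hK' _ (linop_domB (b1 n) (b1 m)); apply.
  rewrite sp_injB//; apply: ler_pM; rewrite ?hnorm_ge0//; first by rewrite /a; lra.
  by rewrite (le_trans (ler_hdistD w _ _))// (hdistC w) lerD.
- move=> n; rewrite eu.
  have -> : f (sp_inj Y (b n)) = f1 (sp_inj Y1 (b n)).
    by case: fP => /(_ _ (bY n))[_ ->] _ _; case: f1P => /(_ _ (b1 n))[_ ->].
  rewrite -linearB (le_trans (fC _))//; apply: ler_pM; rewrite ?hnorm_ge0 ?(ltW C10)//.
  by rewrite /a; lra.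
- move=> n; set d := n.+1%:R^-1.
  have d0 : 0 < d by rewrite invr_gt0.
  have step : hnorm (sp_inj Y (b n)) ^+ 2 <= (bound * hnorm (sp_inj X u)) ^+ 2 + K * d ^+ 2.
    (* The chain is h <= g on the side of Q, then the estimate through T, then g <= 3 c^4 h at the
       arguments (M1/M0)^2 lam on the side of A. *)
    rewrite -lee_fin (sp_inj_hnorm etaP)//.
    apply: (le_trans (integral_interp_le_cpl EQ psiB eta0P eta1P (b n) maj)).
    apply: (le_trans (hK _ _ d0 (ccP n))); rewrite EFinD leeD2r//.
    have := integral_cpl_le_interp psiB psi_c phi0P phi1P l0 mB Bu upper al0 be0 sok lamB.
    have c0 : (0 <= (8 / 3 * M0 ^+ 2)%:E :> \bar R)%E.
      by rewrite lee_fin mulr_ge0 ?sqr_ge0.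
    move=> /(lee_wpmul2l c0)/le_trans; apply.
    rewrite -(sp_inj_hnorm (X := X) phiP)// -!EFinM lee_fin !exprMn sqr_sqrtr//.
    by rewrite le_eqVlt; apply/orP; left; apply/eqP; field.
  have h : (bound * hnorm (sp_inj X u)) ^+ 2 + K * d ^+ 2 <=
      (bound * hnorm (sp_inj X u) + Num.sqrt K * d) ^+ 2.
    have := mulr_ge0 (mulr_ge0 bound0 (hnorm_ge0 (sp_inj X u))) (mulr_ge0 K2 (ltW d0)).
    rewrite sqrrD [(Num.sqrt K * d) ^+ 2]exprMn sqr_sqrtr//; lra.
  have r0 : 0 <= bound * hnorm (sp_inj X u) + Num.sqrt K * d.
    by rewrite addr_ge0// mulr_ge0 ?hnorm_ge0// ltW.
  have := le_trans step h; rewrite ler_pXn2r ?nnegrE ?hnorm_ge0// => /le_trans; apply.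
  by rewrite lerD2l ler_wpM2r ?(ltW d0)// /a; lra.
Qed.

Lemma interp_bound_dense (x : X) (d : R) : 0 < d -> exists u B L,
  [/\ dom (sp_op X1) u, dom (sp_op X) u, measurable B, EA B u = u &
   (forall t, D t -> B t -> phi1 t / phi0 t <= L) /\ hnorm (sp_inj X u - x) < d].
Proof.
move=> d0; have d20 : 0 < d / 2 by rewrite divr_gt0.
have [u uX ux] := sp_approx x d20.
have [n un] := sp_inj_proj_cvg phiP mtruncation truncation_nd truncationT uX d20.
exists (EA (truncation n) u), (truncation n), n%:R; split => //.
- exact: dom_truncation.
- exact: sp_dom_proj.
- exact: mtruncation.
- exact: pm_projK.
split; first by move=> t Dt /(truncation_le Dt)[].
rewrite (le_lt_trans (ler_hdistD (sp_inj X u) _ _))// [ltRHS]splitr.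
exact: ltrD.
Qed.

(** Truncated vectors are closed under subtraction, with supports united and bounds replaced by
    their maximum; so the bound applies to differences and makes the lifts a Cauchy sequence. *)
Lemma interp_bound_all (x : X) :
  exists2 y, f y = T (e x) & hnorm y <= bound * hnorm x.
Proof.
have M0gt0 := opnorm_gt0; have M1gt0 := opnorm1_gt0.
have l0 : 0 < M1 / M0 by rewrite divr_gt0.
have bound0 : 0 <= bound.
  exact: mulr_ge0 (mulr_ge0 (mulr_ge0 (sqr_ge0 _) (sqrtr_ge0 _)) (ltW M0gt0))
    (dilation_function_ge0 psiB psi_c l0).
have f_inj : injective f by case: fP.
have [C C0 eC] : exists2 C : R, 0 < C & forall x, hnorm (e x) <= C * hnorm x.
  by case: eP => _ /continuous_hnorm_bound.
pose nice u := [/\ dom (sp_op X1) u, dom (sp_op X) u &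
  exists B L, [/\ measurable B, EA B u = u &
    forall t, D t -> B t -> phi1 t / phi0 t <= L]].
have nice_lift u : nice u -> exists2 y, f y = T (e (sp_inj X u)) &
    hnorm y <= bound * hnorm (sp_inj X u).
  by move=> [u1 uX [B [L [mB Bu hL]]]]; exact: interp_bound hL.
have niceB u v : nice u -> nice v -> nice (u - v).
  move=> [u1 uX [B [L [mB Bu hL]]]] [v1 vX [B' [L' [mB' Bv hL']]]].
  split; [exact: linop_domB|exact: linop_domB|].
  have mBB : measurable (B `|` B') by exact: measurableU.
  exists (B `|` B'), (Num.max L L'); split => //.
    by rewrite linearB/= -{1}Bu -{1}Bv -!pm_setI// setUK (setUC B) setUK Bu Bv.
  by move=> t Dt [/hL|/hL'] h; rewrite le_max h// orbT.
have /choice[u uP] : forall n : nat, exists u, nice u /\ hnorm (sp_inj X u - x) <= n.+1%:R^-1.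
  move=> n; have n0 : 0 < n.+1%:R^-1 :> R by rewrite invr_gt0.
  have [u [B [L [u1 uX mB Bu [hL ux]]]]] := interp_bound_dense x n0.
  by exists u; split; [split => //; exists B, L|exact: ltW].
have /choice[y yP] : forall n : nat, exists y, f y = T (e (sp_inj X (u n))) /\
    hnorm y <= bound * hnorm (sp_inj X (u n)).
  by move=> n; have [y fy yb] := nice_lift _ (uP n).1; exists y.
have uX n : dom (sp_op X) (u n) by case: (uP n).1.
pose a := bound + M0 * C.
have Ma0 : 0 <= M0 * C by rewrite mulr_ge0 ?ltW.
apply: (lift_limit (y_ := y) (a := a)).
- by case: fP.
- move=> n m; rewrite -mulrDr.
  have [z fz zb] := nice_lift _ (niceB _ _ (uP n).1 (uP m).1).
  (* [f] is injective, so the difference of two lifts is the bounded lift of the difference. *)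
  have -> : y n - y m = z.
    by apply: f_inj; rewrite linearB/= (yP n).1 (yP m).1 fz sp_injB// !linearB.
  apply: (le_trans zb); apply: ler_pM; rewrite ?hnorm_ge0//; first by rewrite /a; lra.
  rewrite sp_injB// (le_trans (ler_hdistD x _ _))// (hdistC x) lerD//.
    exact: (uP n).2.
  exact: (uP m).2.
- move=> n; rewrite (yP n).1 -!linearB.
  rewrite (le_trans (opnorm_bound T_bounded _))//.
  apply: (@le_trans _ _ (M0 * (C * n.+1%:R^-1))).
    by rewrite ler_wpM2l ?(ltW M0gt0)// (le_trans (eC _))// ler_wpM2l ?(ltW C0)// (uP n).2.
  by rewrite mulrA ler_wpM2r ?invr_ge0// /a lerDr.
- move=> n; apply: (le_trans (yP n).2).
  apply: (@le_trans _ _ (bound * (hnorm x + n.+1%:R^-1))).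
    rewrite ler_wpM2l// (_ : sp_inj X (u n) = x + (sp_inj X (u n) - x)); last first.
      by rewrite addrC subrK.
    by rewrite (le_trans (ler_hnormD _ _))// lerD2l (uP n).2.
  by rewrite mulrDr lerD2l ler_wpM2r ?invr_ge0// /a lerDl.
Qed.

End interpolated_operator.

Unset Implicit Arguments.

Theorem theorem4p2 (R : realType)
  (H G : hilbertType R)
  (H_separable : separable H) (H_infinite : ~ finite_dimensional H)
  (G_separable : separable G) (G_infinite : ~ finite_dimensional G)
  (A : linop H) (A_sa : self_adjoint A) (A_unbounded : unbounded A)
  (A_spectrum : spectrum A `<=` [set z | 1 <= z])
  (Q : linop G) (Q_sa : self_adjoint Q) (Q_unbounded : unbounded Q)
  (Q_spectrum : spectrum Q `<=` [set z | 1 <= z])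
  (EA : proj_measure H) (EA_A : spectral_decomposition A EA)
  (EQ : proj_measure G) (EQ_Q : spectral_decomposition Q EQ)
  (phi0 phi1 eta0 eta1 : R -> R)
  (phi0P : borel_positive phi0) (phi1P : borel_positive phi1)
  (eta0P : borel_positive eta0) (eta1P : borel_positive eta1)
  (phi01_bounded : [bounded phi0 t / phi1 t | t in `[1, +oo[])
  (eta01_bounded : [bounded eta0 t / eta1 t | t in `[1, +oo[])
  (psi : R -> R) (psiB : classB psi)
  (psi_pseudoconcave : pseudoconcave_near_infty psi)
  (c : R) (c_gt0 : 0 < c)
  (psi_c : forall t tau : R, 0 < t -> 0 < tau ->
     psi t / psi tau <= c * Num.max 1 (t / tau))
  (X0 : phi_space EA phi0) (X1 : phi_space EA phi1)
  (X : phi_space EA (interp_parameter phi0 phi1 psi))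
  (Y0 : phi_space EQ eta0) (Y1 : phi_space EQ eta1)
  (Y : phi_space EQ (interp_parameter eta0 eta1 psi))
  (e1 : {linear X1 -> X0}) (e1P : is_embedding e1)
  (e : {linear X -> X0}) (eP : is_embedding e)
  (f1 : {linear Y1 -> Y0}) (f1P : is_embedding f1)
  (f : {linear Y -> Y0}) (fP : is_embedding f)
  (T : {linear X0 -> Y0}) (T_neq0 : exists u, T u != 0)
  (T_bounded : continuous T)
  (T1 : {linear X1 -> Y1}) (T1_restr : is_restriction e1 f1 T T1)
  (T1_bounded : continuous T1) :
  exists S : {linear X -> Y}, [/\ is_restriction e f T S,
    continuous S &
    opnorm S <= c ^+ 2 * Num.sqrt 8 * opnorm T *
                dilation_function psi (opnorm T1 / opnorm T)].
Proof.
have M0gt0 := opnorm_gt0 T_neq0 T_bounded.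
have M1gt0 := opnorm1_gt0 phi0P phi1P e1P T_neq0 T_bounded T1_restr T1_bounded.
have l0 : 0 < opnorm T1 / opnorm T by rewrite divr_gt0.
set b := _ * dilation_function psi _.
have b0 : 0 <= b.
  exact: mulr_ge0 (mulr_ge0 (mulr_ge0 (sqr_ge0 _) (sqrtr_ge0 _)) (ltW M0gt0))
    (dilation_function_ge0 psiB psi_c l0).
have f_inj : injective f by case: fP.
have /choice[S SP] : forall x, exists y, f y = T (e x) /\ hnorm y <= b * hnorm x.
  move=> x; have [y fy yb] := interp_bound_all phi0P phi1P eta0P eta1P phi01_bounded
    psiB psi_c e1P eP f1P fP T_neq0 T_bounded T1_restr T1_bounded x.
  by exists y.
(* The chosen values are unique by injectivity of [f], and so inherit linearity from [T] and [e]. *)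
have S_linear : linear S.
  move=> a x y; apply: f_inj; rewrite linearP !(SP _).1.
  by rewrite !linearP.
pose Sl : {linear X -> Y} := HB.pack S (GRing.isLinear.Build _ _ _ _ S S_linear).
exists Sl; split.
- by move=> x; rewrite /= (SP x).1.
- by apply: (hnorm_bound_continuous (M := b)) => x; exact: (SP x).2.
- by apply: opnorm_le => // x; exact: (SP x).2.
Qed.
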